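(* Let $n\ge 1$, $G=SO_{2n}$, and let $B\subset G$ and $L\subset G$, $L\cong GL_n$, be as in the context. Given a $DIII$ $(n,n)$-clan $\gamma=c_1\cdots c_{2n}$ with default permutation $\sigma$, define a flag $V_\bullet(\gamma)=\langle \mathbf v_1,\dots,\mathbf v_{2n}\rangle$ by the following assignments. (1) If $c_i=\pm$, set $\mathbf v_i=\mathbf e_{\sigma(i)}$. (2) If $c_i=c_j\in\mathbb N$ with $i<j$ (so that $c_{2n+1-i}=c_{2n+1-j}$ as well) and $i<2n+1-j$, set $$\mathbf v_i=\tfrac{1}{\sqrt2}(\mathbf e_{\sigma(i)}+\mathbf e_{\sigma(j)}),\qquad \mathbf v_j=\tfrac{1}{\sqrt2}(\mathbf e_{\sigma(i)}-\mathbf e_{\sigma(j)}),$$ $$\mathbf v_{2n+1-i}=\tfrac{1}{\sqrt2}(\mathbf e_{\sigma(2n+1-i)}+\mathbf e_{\sigma(2n+1-j)}),\qquad \mathbf v_{2n+1-j}=\tfrac{1}{\sqrt2}(\mathbf e_{\sigma(2n+1-i)}-\mathbf e_{\sigma(2n+1-j)}).$$ Then $V_\bullet(\gamma)$ is a representative flag for the $L$-orbit $Q_\gamma\subset G/B$. Furthermore, if $g_\gamma$ is the matrix whose $i$-th column is $\mathbf v_i$, then $g_\gamma\in G$ and $Q_\gamma=Lg_\gamma B/B$. The flags (equivalently, matrices) obtained in this way from all $DIII$ $(n,n)$-clans constitute a full set of representatives for the $L$-orbits in $G/B$ (exactly one for each orbit).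
   Context: Groups (over $\mathbb C$). $J_{m}$ is the $m\times m$ matrix with 1's on the antidiagonal and 0's elsewhere. $G=SO_{2n}=\{g\in SL_{2n}: g^tJ_{2n}g=J_{2n}\}$; $B$ is the subgroup of upper triangular matrices in $G$; $L=\{\mathrm{diag}(A,\,J_n(A^{-1})^tJ_n): A\in GL_n\}\subset G$ (block diagonal). $\mathbf e_1,\dots,\mathbf e_{2n}$ is the standard basis of $\mathbb C^{2n}$, $E_n=\mathrm{span}(\mathbf e_1,\dots,\mathbf e_n)$, $\tilde E_n=\mathrm{span}(\mathbf e_{n+1},\dots,\mathbf e_{2n})$. Flags. $\langle \mathbf v_1,\dots,\mathbf v_{2n}\rangle$ denotes the full flag with $V_i=\mathrm{span}(\mathbf v_1,\dots,\mathbf v_i)$. A coset $gB\in G/B$ is identified with the flag $\langle \mathbf v_1,\dots,\mathbf v_{2n}\rangle$ where $\mathbf v_i$ is the $i$-th column of $g$. Thus $G/B$ is the set of full flags $V_\bullet$ in $\mathbb C^{2n}$ with $V_{2n-i}=V_i^\perp$ (with respect to the form $J_{2n}$) and $\dim(V_n\cap E_n)\equiv n \pmod 2$. Clans. An $(n,n)$-clan is a string $\gamma=c_1\cdots c_{2n}$ of symbols from $\mathbb N\cup\{+,-\}$ with equally many $+$'s and $-$'s, in which every natural number that appears appears exactly twice; two clans are equal if they have the same signs at the same positions and the same positions of matching number pairs. $rev(\gamma)=c_{2n}\cdots c_1$, and $\overline\gamma$ is obtained by exchanging $+$ and $-$. A $DIII$ $(n,n)$-clan is an $(n,n)$-clan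 such that (i) $\gamma=rev(\overline\gamma)$; (ii) if $c_i\in\mathbb N$ then $c_i\ne c_{2n+1-i}$; (iii) the number of $-$'s among $c_1,\dots,c_n$ plus the number of pairs $i<j\le n$ with $c_i=c_j\in\mathbb N$ is even. Default permutation. Give each position of $\gamma$ a signature: positions with $c_i=\pm$ have signature $c_i$; if $c_i=c_j\in\mathbb N$ with $i<j$, then position $i$ has signature $-$ and position $j$ has signature $+$. The default permutation $\sigma\in\mathcal S_{2n}$ is defined for $i\le n$ by: $\sigma(i)=i$ and $\sigma(2n+1-i)=2n+1-i$ if position $i$ has signature $+$; $\sigma(i)=2n+1-i$ and $\sigma(2n+1-i)=i$ if position $i$ has signature $-$. Orbits. For a $DIII$ clan $\gamma$, $Q_\gamma$ is the set of flags $V_\bullet\in G/B$ such that for all $i$ and all $i<j$: $\dim(V_i\cap E_n)$ is the number of $+$'s plus the number of completed matching pairs (both members) among $c_1,\dots,c_i$; $\dim(V_i\cap\tilde E_n)$ is the number of $-$'s plus the number of completed matching pairs among $c_1,\dots,c_i$; and $\dim(\mathrm{pr}(V_i)+V_j)=j+\#\{(s,t): c_s=c_t\in\mathbb N,\ s\le i<j<t\}$, where $\mathrm{pr}:\mathbb C^{2n}\to E_n$ is the projection with kernel $\tilde E_n$. It is known that $\gamma\mapsto Q_\gamma$ is a bijection from $DIII$ $(n,n)$-clans to $L$-orbits in $G/B$. *)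

(* Defs.v *)
From HB Require Import structures.
From mathcomp Require Import all_boot all_order all_algebra perm.
From mathcomp Require Import all_classical reals.
From mathcomp Require Import complex zify.

Set Implicit Arguments.
Unset Strict Implicit.
Unset Printing Implicit Defensive.

Import Order.TTheory GRing.Theory Num.Theory.

Local Open Scope classical_set_scope.
Local Open Scope ring_scope.

(* Positions are 0-based: the position written i in 1..2n is the ordinal of
   value i - 1 in 'I_(n + n), so that [rev_ord] is i |-> 2n+1-i. *)

Definition antidiag_mx (C : numClosedFieldType) m : 'M[C]_m :=
  \matrix_(i, j) (j == rev_ord i)%:R.

Definition SO_group (C : numClosedFieldType) n : set 'M[C]_(n + n) :=
  [set g | \det g = 1 /\
           g^T *m antidiag_mx C (n + n) *m g = antidiag_mx C (n + n)].

(* [is_trig_mx] means lower triangular, hence the transpose. *)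
Definition borel (C : numClosedFieldType) n : set 'M[C]_(n + n) :=
  [set b | SO_group b /\ is_trig_mx b^T].

Definition levi (C : numClosedFieldType) n : set 'M[C]_(n + n) :=
  [set l | exists2 A : 'M[C]_n, A \in unitmx &
     l = block_mx A 0 0 (antidiag_mx C n *m (invmx A)^T *m antidiag_mx C n)].

Definition std_vec (C : numClosedFieldType) n (i : 'I_(n + n)) : 'cV[C]_(n + n) :=
  delta_mx i 0.

Definition E_space (C : numClosedFieldType) n : {vspace 'cV[C]_(n + n)} :=
  <<[seq std_vec C i | i in [pred i : 'I_(n + n) | (i < n)%N]]>>%VS.

Definition Et_space (C : numClosedFieldType) n : {vspace 'cV[C]_(n + n)} :=
  <<[seq std_vec C i | i in [pred i : 'I_(n + n) | (n <= i)%N]]>>%VS.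

(* The projection onto [E_space] with kernel [Et_space]. *)
Definition pr_E (C : numClosedFieldType) n : 'End('cV[C]_(n + n)) :=
  linfun (mulmx (pid_mx n : 'M[C]_(n + n))).

(* V_0, ..., V_2n; being a full isotropic flag of the right parity comes from
   membership in [GmodB]. *)
Definition flag (C : numClosedFieldType) n :=
  {ffun 'I_(n + n).+1 -> {vspace 'cV[C]_(n + n)}}.

Definition flag_of_vecs (C : numClosedFieldType) n
    (v : 'I_(n + n) -> 'cV[C]_(n + n)) : flag C n :=
  [ffun k : 'I_(n + n).+1 =>
     <<[seq v i | i in [pred i : 'I_(n + n) | (i < k)%N]]>>%VS].

Definition flag_of_mx (C : numClosedFieldType) n (g : 'M[C]_(n + n)) : flag C n :=
  flag_of_vecs (fun i => col i g).

(* The coset gB is identified with the flag of the columns of g; see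
   [flag_of_mx_eqP]. *)
Definition GmodB (C : numClosedFieldType) n : set (flag C n) :=
  [set flag_of_mx g | g in @SO_group C n].

Definition act_flag (C : numClosedFieldType) n (l : 'M[C]_(n + n)) (V : flag C n) :
    flag C n :=
  [ffun k => (linfun (mulmx l) @: V k)%VS].

Definition L_orbit (C : numClosedFieldType) n (V : flag C n) : set (flag C n) :=
  [set act_flag l V | l in @levi C n].

Definition L_orbits (C : numClosedFieldType) n : set (set (flag C n)) :=
  [set L_orbit V | V in @GmodB C n].

Definition LgB (C : numClosedFieldType) n (g : 'M[C]_(n + n)) : set 'M[C]_(n + n) :=
  [set l *m g *m b | l in @levi C n & b in @borel C n].

Definition LgBmodB (C : numClosedFieldType) n (g : 'M[C]_(n + n)) : set (flag C n) :=
  [set flag_of_mx x | x in LgB g].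

Definition symbol := (bool + nat)%type.
Definition plus : symbol := inl true.
Definition minus : symbol := inl false.

Definition is_number (c : symbol) : bool := if c is inr _ then true else false.

Definition flip (c : symbol) : symbol := if c is inl s then inl (~~ s) else c.

Definition clan_string n := {ffun 'I_(n + n) -> symbol}.

Definition matched n (c : clan_string n) (i j : 'I_(n + n)) : bool :=
  [&& i != j, is_number (c i) & c i == c j].

(* Equality of clans: the actual numbers used are irrelevant. *)
Definition clan_eq n (c d : clan_string n) : Prop :=
  [/\ forall i, (c i == plus) = (d i == plus),
      forall i, (c i == minus) = (d i == minus) &
      forall i j, matched c i j = matched d i j].

Definition is_clan n (c : clan_string n) : Prop :=
  #|[pred i | c i == plus]| = #|[pred i | c i == minus]| /\
  forall i, is_number (c i) -> #|[pred j | c j == c i]| = 2%N.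

Definition rev_clan n (c : clan_string n) : clan_string n :=
  [ffun i => c (rev_ord i)].

Definition bar_clan n (c : clan_string n) : clan_string n :=
  [ffun i => flip (c i)].

(* Counts among the first [k] symbols. *)
Definition num_plus n (c : clan_string n) (k : nat) : nat :=
  #|[pred i : 'I_(n + n) | (i < k)%N && (c i == plus)]|.

Definition num_minus n (c : clan_string n) (k : nat) : nat :=
  #|[pred i : 'I_(n + n) | (i < k)%N && (c i == minus)]|.

Definition num_pairs n (c : clan_string n) (k : nat) : nat :=
  #|[pred p : 'I_(n + n) * 'I_(n + n) |
      [&& (p.1 < p.2)%N, (p.2 < k)%N & matched c p.1 p.2]]|.

(* Pairs s <= i < j < t, in 1-based positions s and t. *)
Definition num_straddling n (c : clan_string n) (i j : nat) : nat :=
  #|[pred p : 'I_(n + n) * 'I_(n + n) |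
      [&& (p.1 < i)%N, (j <= p.2)%N & matched c p.1 p.2]]|.

Definition DIII_clan n (c : clan_string n) : Prop :=
  [/\ is_clan c,
      clan_eq c (rev_clan (bar_clan c)),
      forall i, is_number (c i) -> c i <> c (rev_ord i) &
      ~~ odd (num_minus c n + num_pairs c n)].

Definition orbit_of_clan (C : numClosedFieldType) n (c : clan_string n) :
    set (flag C n) :=
  [set V | [/\ GmodB V,
    forall k : 'I_(n + n).+1,
      \dim (V k :&: E_space C n)%VS = (num_plus c k + num_pairs c k)%N,
    forall k : 'I_(n + n).+1,
      \dim (V k :&: Et_space C n)%VS = (num_minus c k + num_pairs c k)%N &
    forall i j : 'I_(n + n).+1, (i < j)%N ->
      \dim (pr_E C n @: V i + V j)%VS = (j + num_straddling c i j)%N]].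

Arguments orbit_of_clan C {n} c _.

Definition signature n (c : clan_string n) (i : 'I_(n + n)) : bool :=
  if c i is inl s then s
  else [exists j : 'I_(n + n), (j < i)%N && matched c j i].

Definition default_fun n (c : clan_string n) (i : 'I_(n + n)) : 'I_(n + n) :=
  if signature c (if (i < n)%N then i else rev_ord i) then i else rev_ord i.

Lemma default_fun_inj n (c : clan_string n) : injective (default_fun c).
Proof.
have half (i : 'I_(n + n)) : (rev_ord i < n)%N = ~~ (i < n)%N.
  by rewrite /= -leqNgt ltn_subLR // addSn ltnS leq_add2r.
apply: (can_inj (g := default_fun c)) => i; rewrite /default_fun.
set k := if (i < n)%N then i else rev_ord i.
case Es: (signature c k); first by rewrite -/k Es.
have -> : (if (rev_ord i < n)%N then rev_ord i else rev_ord (rev_ord i)) = k.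
  by rewrite half rev_ordK /k; case: (i < n)%N.
by rewrite Es rev_ordK.
Qed.

Definition default_perm n (c : clan_string n) : 'S_(n + n) :=
  perm (@default_fun_inj n c).

(* [j] is the position matched with [i], if any; that the signs are the
   intended ones is [repr_vec_pair]. *)
Definition repr_vec (C : numClosedFieldType) n (c : clan_string n)
    (i : 'I_(n + n)) : 'cV[C]_(n + n) :=
  let e k := std_vec C (default_perm c k) in
  if [pick j | matched c i j] is Some j then
    (sqrtC 2)^-1 *:
      (if (i < j)%N == (i < rev_ord j)%N then e i + e j else e j - e i)
  else e i.

Definition repr_flag (C : numClosedFieldType) n (c : clan_string n) :
    flag C n :=
  flag_of_vecs (repr_vec C c).

Definition repr_mx (C : numClosedFieldType) n (c : clan_string n) :
    'M[C]_(n + n) :=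
  \matrix_(i, j) repr_vec C c j i 0.

Lemma matchedC n (c : clan_string n) i j : matched c i j = matched c j i.
Proof.
rewrite /matched (eq_sym j) (eq_sym (c j)).
by case: (c i =P c j) => [->|_]; rewrite ?andbF.
Qed.

Lemma pick_matched n (c : clan_string n) i j :
  is_clan c -> matched c i j -> [pick k | matched c i k] = Some j.
Proof.
move=> [_ cP] ij; case: pickP => [k ik|/(_ j)]; last by rewrite ij.
have [//|kj] := eqVneq k j; first by move->.
case/and3P: ij => nij ni /eqP eij; case/and3P: ik => nik _ /eqP eik.
have := cP _ ni; rewrite (cardD1 i) (cardD1 j) (cardD1 k) !inE eqxx.
by rewrite (eq_sym j) nij -eij eqxx kj (eq_sym k) nik -eik eqxx.
Qed.

Lemma repr_vec_sign (C : numClosedFieldType) n (c : clan_string n) i :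
  ~~ is_number (c i) -> repr_vec C c i = std_vec C (default_perm c i).
Proof.
move=> ni; rewrite /repr_vec; case: pickP => // j.
by rewrite /matched (negPf ni) andbF.
Qed.

Lemma matched_rev n (c : clan_string n) i j : DIII_clan c ->
  matched c i j -> matched c (rev_ord i) (rev_ord j).
Proof.
case=> _ [_ _ e] _ _; rewrite e /matched !ffunE => /and3P[ij].
case: (c (rev_ord i)) => //= a _ /eqP; case: (c (rev_ord j)) => //= b [->].
by rewrite (inj_eq rev_ord_inj) ij eqxx.
Qed.

Lemma repr_vec_pair (C : numClosedFieldType) n (c : clan_string n)
    (i j : 'I_(n + n)) :
  DIII_clan c -> matched c i j -> (i < j)%N -> (i < rev_ord j)%N ->
  let e k := std_vec C (default_perm c k) in
  [/\ repr_vec C c i = (sqrtC 2)^-1 *: (e i + e j),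
      repr_vec C c j = (sqrtC 2)^-1 *: (e i - e j),
      repr_vec C c (rev_ord i) =
        (sqrtC 2)^-1 *: (e (rev_ord i) + e (rev_ord j)) &
      repr_vec C c (rev_ord j) =
        (sqrtC 2)^-1 *: (e (rev_ord i) - e (rev_ord j))].
Proof.
move=> D ij lij lirj e; have [cc _ _ _] := D.
have ji : matched c j i by rewrite matchedC.
have rij := matched_rev D ij; have rji := matched_rev D ji.
have [ltji ltrij ltrji] : [/\ (j < i)%N = false,
  (rev_ord i < rev_ord j)%N = false & (rev_ord j < rev_ord i)%N].
  by move: lij (ltn_ord i) (ltn_ord j) => /=; split; lia.
have [ltjri ltrirrj ltrjrri] : [/\ (j < rev_ord i)%N,
  (rev_ord i < rev_ord (rev_ord j))%N = false &
  (rev_ord j < rev_ord (rev_ord i))%N = false].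
  rewrite !rev_ordK; move: lij lirj (ltn_ord i) (ltn_ord j) => /=; split; lia.
rewrite /repr_vec (pick_matched cc ij) (pick_matched cc ji).
rewrite (pick_matched cc rij) (pick_matched cc rji).
by rewrite lij lirj ltji ltjri ltrij ltrirrj ltrji ltrjrri.
Qed.

Lemma act_flag_of_mx (C : numClosedFieldType) n (g x : 'M[C]_(n + n)) :
  act_flag g (flag_of_mx x) = flag_of_mx (g *m x).
Proof.
apply/ffunP => k; rewrite !ffunE limg_span -map_comp; congr (<<_>>%VS).
by apply: eq_map => i; rewrite /= lfunE /= !colE mulmxA.
Qed.

Lemma mem_flag1 (C : numClosedFieldType) n (v : 'cV[C]_(n + n)) (k : 'I_(n + n).+1) :
  reflect (forall i : 'I_(n + n), (k <= i)%N -> v i 0 = 0)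
          (v \in flag_of_mx 1%:M k).
Proof.
rewrite ffunE; apply: (iffP idP) => [vk i ki|v0].
  pose phi := linfun (row i : 'cV[C]_(n + n) -> 'cV[C]_1).
  have : (<<[seq col j (1%:M : 'M[C]_(n + n)) |
      j in [pred j : 'I_(n + n) | (j < k)%N]]>> <= lker phi)%VS.
    apply/span_subvP => w /mapP[j]; rewrite mem_enum inE => jk ->.
    rewrite memv_ker lfunE; apply/eqP/matrixP => a b; rewrite !mxE.
    by case: eqP ki => // ->; rewrite leqNgt jk.
  move/subvP/(_ v vk); rewrite memv_ker lfunE => /eqP/matrixP/(_ 0 0).
  by rewrite !mxE.
rewrite (matrix_sum_delta v); apply: memv_suml => i _; rewrite big_ord1.
have [ki|ik] := leqP k i; first by rewrite v0 // scale0r mem0v.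
apply/memvZ/memv_span/mapP; exists i; first by rewrite mem_enum.
by apply/matrixP => a b; rewrite !mxE !ord1 eqxx andbT.
Qed.

Lemma SO_unit (C : numClosedFieldType) n (g : 'M[C]_(n + n)) :
  SO_group g -> g \in unitmx.
Proof. by case=> d _; rewrite unitmxE d unitr1. Qed.

Lemma flag_of_mx_trig (C : numClosedFieldType) n (b : 'M[C]_(n + n)) :
  b \in unitmx -> is_trig_mx b^T = (flag_of_mx b == flag_of_mx 1%:M).
Proof.
move=> bu; apply/is_trig_mxP/eqP => [tb|fb i j ij].
  apply/ffunP => k; apply/eqP; rewrite eqEdim; apply/andP; split.
    rewrite {1}/flag_of_mx ffunE; apply/span_subvP => w /mapP[j].
    rewrite mem_enum inE => jk ->; apply/mem_flag1 => i ki.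
    by have := tb j i (leq_trans jk ki); rewrite !mxE.
  have -> : flag_of_mx b k = (linfun (mulmx b) @: flag_of_mx 1%:M k)%VS.
    by rewrite -[b in LHS]mulmx1 -act_flag_of_mx ffunE.
  rewrite limg_dim_eq //.
  apply/eqP; rewrite -subv0; apply/subvP => v; rewrite memv_cap memv_ker.
  case/andP => _; rewrite lfunE /= => /eqP bv0.
  by rewrite -[v](mulKmx bu) bv0 mulmx0 mem0v.
rewrite mxE; have : col i b \in flag_of_mx b (lift ord0 i).
  rewrite ffunE; apply/memv_span/mapP; exists i => //.
  by rewrite mem_enum inE.
by rewrite fb => /mem_flag1/(_ j ij); rewrite mxE.
Qed.

Lemma flag_of_mx_eqP (C : numClosedFieldType) n (g h : 'M[C]_(n + n)) :
  SO_group g -> SO_group h ->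
  flag_of_mx g = flag_of_mx h <-> exists2 b, borel b & h = g *m b.
Proof.
move=> Gg Gh; have gu := SO_unit Gg; split=> [e|[b [Gb tb] ->]]; last first.
  rewrite -act_flag_of_mx.
  have /eqP -> := etrans (esym (flag_of_mx_trig (SO_unit Gb))) tb.
  by rewrite act_flag_of_mx mulmx1.
have hE : h = g *m (invmx g *m h) by rewrite mulKVmx.
exists (invmx g *m h) => //; split.
  case: Gg Gh => dg fg [dh fh]; split.
    by rewrite det_mulmx det_inv dg dh invr1 mulr1.
  rewrite -[X in _ *m X *m _]fg trmx_mul !mulmxA.
  rewrite -!mulmxA mulKVmx // !mulmxA -[RHS]fh.
  by rewrite -(mulmxA h^T) -trmx_mul mulmxV // trmx1 mulmx1.
rewrite flag_of_mx_trig; last first.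
  by rewrite unitmx_mul unitmx_inv gu SO_unit.
by rewrite -act_flag_of_mx -e act_flag_of_mx mulVmx.
Qed.

Lemma levi_SO (C : numClosedFieldType) n (l : 'M[C]_(n + n)) :
  levi l -> SO_group l.
Proof.
have JJ m : antidiag_mx C m *m antidiag_mx C m = 1%:M.
  apply/matrixP => i j; rewrite !mxE (bigD1 (rev_ord i)) //= !mxE eqxx mul1r.
  rewrite rev_ordK eq_sym big1 ?addr0 // => k /negPf ki.
  by rewrite mxE ki mul0r.
have JT m : (antidiag_mx C m)^T = antidiag_mx C m.
  by apply/matrixP => i j; rewrite !mxE eq_sym (can2_eq rev_ordK rev_ordK).
have JE : antidiag_mx C (n + n) =
    block_mx 0 (antidiag_mx C n) (antidiag_mx C n) 0.
  apply/matrixP => i j; rewrite !mxE; case: splitP => a ia; rewrite !mxE;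
  case: splitP => b jb; rewrite !mxE -!val_eqE /= ia jb;
  do ?[case: eqP => ?] => //=; have := ltn_ord a; have := ltn_ord b; lia.
case=> A Au ->; split.
  rewrite det_ublock !det_mulmx det_tr det_inv mulrAC -det_mulmx JJ det1 mul1r.
  by rewrite mulrV // -unitmxE.
rewrite JE tr_block_mx !trmx0 !mulmx_block !(mulmx0, mul0mx, addr0, add0r).
congr block_mx.
  rewrite -!mulmxA (mulmxA (antidiag_mx C n) (antidiag_mx C n)) JJ mul1mx.
  by rewrite mulmxA -trmx_mul mulVmx // trmx1 mul1mx.
rewrite !trmx_mul trmxK JT -!mulmxA.
by rewrite (mulmxA (antidiag_mx C n) (antidiag_mx C n)) JJ mul1mx mulVmx ?mulmx1.
Qed.

(* Main.v *)
(** Let K = diag(1_n, -1_n).  Since K is anti-selfadjoint for the form J, the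
    subgroup L is the centralizer of K in G, and for g in G the L-orbit of gB is
    determined by T = g^-1 K g up to conjugation by B.  Every such T is conjugate
    under B to a signed permutation matrix e_p |-> +-e_(m p) with m an involution:
    take the first basis vector x_i not yet treated; either T x_i = +-x_i, or the
    top coordinate j of T x_i gives a partner x_j := -T x_i.  In both cases dual
    vectors with leading positions rev i (and rev j) can be found, they span with
    x_i (and x_j) a nondegenerate T-stable space, and the other basis vectors are
    projected to its orthogonal without changing the flag.

    The pairs (m, signs) occurring are the clans, and the columns of [repr_mx c]
    satisfy K v_p = +-v_(m p) with the same signs; so g b = l * repr_mx c with l
    commuting with K, that is l in L.  A relation K g = g T of this form makes the
    dimensions defining Q_c explicit, and these dimensions determine the clan.  The
    parity condition on clans is [\det (repr_mx c) = 1]. *)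

From HB Require Import structures.
Require Import Defs.
From mathcomp Require Import all_boot all_order all_algebra.
From mathcomp Require Import all_classical reals complex.
From mathcomp Require Import perm zify ring.

Set Implicit Arguments.
Unset Strict Implicit.
Unset Printing Implicit Defensive.

Import Order.TTheory GRing.Theory Num.Theory.

Local Open Scope classical_set_scope.
Local Open Scope ring_scope.

(** * Normal form of T under the Borel subgroup *)

Section NormalForm.
Variables (C : numClosedFieldType) (n : nat).
Notation N := (n + n)%N.
Notation J := (antidiag_mx C N).
Notation cV := 'cV[C]_N.
Notation idx := 'I_N.

Lemma rev_neq (i : idx) : rev_ord i != i.
Proof. by apply/eqP => /(congr1 val) /=; have := ltn_ord i; lia. Qed.

Lemma ltn_rev2 (i j : idx) : (rev_ord i < rev_ord j)%N = (j < i)%N.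
Proof. by move=> /=; have := ltn_ord i; have := ltn_ord j; lia. Qed.

Lemma ltn_revC (i j : idx) : (rev_ord i < j)%N = (rev_ord j < i)%N.
Proof. by move=> /=; have := ltn_ord i; have := ltn_ord j; lia. Qed.

Lemma ltn_revr (i j : idx) : (i < rev_ord j)%N = (j < rev_ord i)%N.
Proof. by move=> /=; have := ltn_ord i; have := ltn_ord j; lia. Qed.

Lemma ltn_revl (i j : idx) : (i < j)%N -> (i < rev_ord j)%N -> (i < rev_ord i)%N.
Proof. by move=> /=; have := ltn_ord i; have := ltn_ord j; lia. Qed.

Lemma rev_distinct (i j : idx) : (i < j)%N -> (i < rev_ord j)%N ->
  ((i == j) = false) * ((j == i) = false) * ((i == rev_ord j) = false) *
  ((rev_ord j == i) = false) * ((i == rev_ord i) = false) * ((rev_ord i == i) = false) *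
  ((j == rev_ord i) = false) * ((rev_ord i == j) = false) * ((j == rev_ord j) = false) *
  ((rev_ord j == j) = false) * ((rev_ord i == rev_ord j) = false) * ((rev_ord j ==
    rev_ord i) = false).
Proof.
move=> /= ij irj.
by do ![apply: pair]; apply/negbTE; rewrite -val_eqE /=;
  move: ij irj (ltn_ord i) (ltn_ord j); lia.
Qed.

(** * The bilinear form of [J] and leading positions *)

Definition dot (x y : cV) : C := (x^T *m J *m y) 0 0.

Lemma dotE x y : dot x y = \sum_i x (rev_ord i) 0 * y i 0.
Proof.
rewrite /dot mxE; apply: eq_bigr => i _; congr (_ * _).
rewrite mxE (bigD1 (rev_ord i)) //= !mxE rev_ordK eqxx mulr1 big1 ?addr0 // => k ki.
by rewrite !mxE -(inj_eq rev_ord_inj) rev_ordK eq_sym (negPf ki) mulr0.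
Qed.

Lemma dotC x y : dot x y = dot y x.
Proof.
rewrite !dotE (reindex_inj rev_ord_inj); apply: eq_bigr => i _.
by rewrite rev_ordK mulrC.
Qed.

Lemma dotDl x y z : dot (x + y) z = dot x z + dot y z.
Proof. by rewrite /dot linearD /= !mulmxDl mxE. Qed.

Lemma dotZl a x z : dot (a *: x) z = a * dot x z.
Proof. by rewrite /dot linearZ /= -!scalemxAl mxE. Qed.

Lemma dotNl x z : dot (- x) z = - dot x z.
Proof. by rewrite -scaleN1r dotZl mulN1r. Qed.

Lemma dot_suml (I : Type) (r : seq I) (P : pred I) (F : I -> cV) z :
  dot (\sum_(i <- r | P i) F i) z = \sum_(i <- r | P i) dot (F i) z.
Proof.
apply: (big_morph (dot^~ z)) => [x y|]; first exact: dotDl.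
by rewrite -(scale0r 0) dotZl mul0r.
Qed.

Lemma dotDr x y z : dot z (x + y) = dot z x + dot z y.
Proof. by rewrite !(dotC z) dotDl. Qed.

Lemma dotZr a x z : dot z (a *: x) = a * dot z x.
Proof. by rewrite !(dotC z) dotZl. Qed.

Lemma dotNr x z : dot z (- x) = - dot z x.
Proof. by rewrite !(dotC z) dotNl. Qed.

(** [below k x] puts [x] in the span of the first [k + 1] standard vectors. A family with
    [lead k (x k)] for every [k] forms the columns of an invertible upper triangular matrix. *)
Definition below (k : idx) (x : cV) := forall l : idx, (k < l)%N -> x l 0 = 0.

Definition lead (k : idx) (x : cV) := below k x /\ x k 0 != 0.

(** Each term of [dot] pairs coordinate [i] of one vector with coordinate [rev_ord i] of the other,
    and here one of the two is always past its bound. *)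
Lemma dot_below k l x y : below k x -> below l y -> (l < rev_ord k)%N ->
  dot x y = 0.
Proof.
move=> xk yl lk; rewrite dotE big1 // => i _.
have [li|il] := ltnP l i; first by rewrite yl ?mulr0.
rewrite xk ?mul0r //=; move: lk (ltn_ord i) (ltn_ord k) => /=; lia.
Qed.

Lemma dot_lead k x y : below k x -> below (rev_ord k) y ->
  dot x y = x k 0 * y (rev_ord k) 0.
Proof.
move=> xk yk; rewrite dotE (bigD1 (rev_ord k)) //= rev_ordK big1 ?addr0 // => i ik.
have [ki|ik'] := ltnP (rev_ord k) i; first by rewrite yk ?mulr0.
rewrite xk ?mul0r //=; move: ik ik' (ltn_ord i) (ltn_ord k).
rewrite -val_eqE /=; lia.
Qed.

Lemma exists_lead (x : cV) : x != 0 -> exists k, lead k x.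
Proof.
move=> x0; have [i xi] : exists i, x i 0 != 0.
  apply/existsP; apply: contraNT x0; rewrite negb_exists => /forallP x0.
  by apply/eqP/matrixP => i j; rewrite mxE ord1; apply/eqP; rewrite -[_ == _]negbK.
have [k xk kmax] := @arg_maxnP _ i (fun k => x k 0 != 0) (fun k => k : nat) xi.
exists k; split=> // l kl; apply/eqP; apply: contraLR kl => xl.
by rewrite -leqNgt; apply: kmax.
Qed.

(** * An involution [T], anti-selfadjoint for the form, and bases adapted to it *)

Variable T : 'M[C]_N.
Hypothesis TT : T *m T = 1%:M.
Hypothesis TJ : T^T *m J = - (J *m T).

Lemma mulTK (x : cV) : T *m (T *m x) = x.
Proof. by rewrite mulmxA TT mul1mx. Qed.

Lemma dotT (x y : cV) : dot (T *m x) y = - dot x (T *m y).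
Proof. by rewrite /dot trmx_mul -!mulmxA (mulmxA T^T) TJ mulNmx mulmxN !mulmxA mxE. Qed.

(** By symmetry of the form and [dotT] the value is its own negative. This makes eigenvectors of [T]
    isotropic and keeps the partner of a position [i] away from [rev_ord i]. *)
Lemma dotTx (x : cV) : dot x (T *m x) = 0.
Proof.
have := dotT x x; rewrite dotC => /eqP; rewrite -addr_eq0 -mulr2n mulrn_eq0 /=.
by move/eqP.
Qed.

(* [m] is the matching, with the signs as its fixed points, and [d p] says that the
   sign at a fixed point [p] is +. *)
Definition tsign (m : idx -> idx) (d : idx -> bool) p : C :=
  if m p == p then (if d p then 1 else -1)
  else if (p < rev_ord (m p))%N then -1 else 1.

(** Conditions (i) and (ii) on a DIII clan, stated for a matching and its signs on a set [P] stable
    under [m] and [rev_ord]. *)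
Definition paired (P : pred idx) (m : idx -> idx) (d : idx -> bool) := forall p, P p ->
  [/\ P (rev_ord p), P (m p), m (m p) = p, m (rev_ord p) = rev_ord (m p) &
      m p != rev_ord p /\ (m p = p -> d (rev_ord p) = ~~ d p)].

Definition block (P : pred idx) m d (x : idx -> cV) := forall p, P p ->
  [/\ lead p (x p), T *m x p = tsign m d p *: x (m p) &
      forall q, P q -> dot (x p) (x q) = (q == rev_ord p)%:R].

(** [P] is the set of positions already treated. The vectors at the other positions only keep their
    leading positions and are orthogonal to the treated ones. *)
Definition partial (P : pred idx) m d x :=
  [/\ paired P m d, block P m d x, forall k, lead k (x k) &
      forall p k, P p -> ~~ P k -> dot (x p) (x k) = 0].

(* The coefficient of [y q] in the correction of [x k] pairs [x k] with [y (rev q)],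
   so it vanishes unless [q < k]: leading positions are preserved. *)
Lemma partial_union (P Q : pred idx) m d x m' d' y :
  partial P m d x -> paired Q m' d' -> block Q m' d' y ->
  (forall q, Q q -> ~~ P q) ->
  (forall p q, P p -> Q q -> dot (x p) (y q) = 0) ->
  exists m'' d'' x'', partial (fun k => P k || Q k) m'' d'' x''.
Proof.
move=> [pP bP lx ox] pQ bQ PQ xy.
exists (fun k => if Q k then m' k else m k), (fun k => if Q k then d' k else d k).
(* The remaining vectors are projected to the orthogonal of the new block, in which [y (rev_ord q)]
   is dual to [y q]. *)
pose z k := if Q k then y k
  else x k - \sum_(q | Q q) dot (x k) (y (rev_ord q)) *: y q.
have QP p : P p -> Q p = false by move=> Pp; apply/negbTE; apply/negP => /PQ;
  rewrite Pp.
have zP p : P p -> z p = x p.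
  move=> Pp; rewrite /z QP // big1 ?subr0 // => q Qq.
  by have [Qr _ _ _ _] := pQ _ Qq; rewrite xy ?scale0r.
have zQ q : Q q -> z q = y q by rewrite /z => ->.
have yz q k : Q q -> ~~ Q k -> dot (y q) (z k) = 0.
  move=> Qq Qk; rewrite /z (negPf Qk) dotDr dotNr (dotC (y q) (\sum_(i | _) _)).
  rewrite dot_suml (bigD1 (rev_ord q)) /=; last by case: (pQ _ Qq).
  rewrite dotZl rev_ordK.
  have [Qr _ _ _ _] := pQ _ Qq.
  have [_ _ ->] := bQ _ Qr => //.
  rewrite rev_ordK eqxx mulr1 big1 ?addr0; first by rewrite dotC subrr.
  move=> i /andP[Qi iq]; rewrite dotZl; have [_ _ ->] := bQ _ Qi => //.
  by rewrite -(inj_eq rev_ord_inj) rev_ordK eq_sym (negPf iq) mulr0.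
exists z; split.
- move=> p /= /orP[Pp|Qp].
    rewrite (QP _ Pp); have [Pr Pm e1 e2 [e3 e4]] := pP _ Pp.
    by rewrite Pr Pm (QP _ Pr) (QP _ Pm); split.
  rewrite Qp; have [Qr Qm e1 e2 [e3 e4]] := pQ _ Qp.
  by rewrite Qr Qm !orbT; split.
- move=> p /= /orP[Pp|Qp].
    have [l1 e1 e2] := bP _ Pp; have [Pr Pm _ _ _] := pP _ Pp.
    rewrite /tsign (QP _ Pp) !zP //; split=> // q /orP[Pq|Qq]; first by rewrite zP ?e2.
    rewrite zQ // xy //; case: (q =P rev_ord p) => // qE.
    by move: (QP _ Pr); rewrite -qE Qq.
  have [l1 e1 e2] := bQ _ Qp; have [Qr Qm _ _ _] := pQ _ Qp.
  rewrite /tsign Qp !zQ //; split=> // q /orP[Pq|Qq]; last by rewrite zQ ?e2.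
  rewrite yz ?(QP _ Pq) //; case: (q =P rev_ord p) => // qE.
  by move: (QP _ Pq); rewrite qE Qr.
- move=> k; rewrite /z; case: ifPn => [Qk|Qk]; first by case: (bQ _ Qk).
  have [bk k0] := lx k.
  have small (l : idx) : (k <= l)%N ->
      (\sum_(q | Q q) dot (x k) (y (rev_ord q)) *: y q) l 0 = 0.
    move=> kl; rewrite summxE big1 // => q Qq; rewrite mxE.
    have [Qr _ _ _ _] := pQ _ Qq; have [[yq _] _ _] := bQ _ Qq.
    have [[yr _] _ _] := bQ _ Qr.
    have qk : q != k by apply: contraNneq Qk => <-.
    have [kq|qk'] := ltnP k q.
      rewrite (dot_below bk yr) ?mul0r //=; have := ltn_ord q; have := ltn_ord k; lia.
    by rewrite yq ?mulr0 // (leq_trans _ kl) // ltn_neqAle qk.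
  split=> [l kl|]; rewrite !mxE small ?(ltnW kl) ?subr0 //; exact: bk.
- move=> p k /= pPQ; rewrite negb_or => /andP[Pk Qk].
  case/orP: pPQ => [Pp|Qp]; last by rewrite zQ ?yz.
  rewrite zP // /z (negPf Qk) dotDr dotNr ox // dotC dot_suml big1 ?subrr // => q Qq.
  by rewrite dotZl (dotC (y q)) (xy p) ?mulr0.
Qed.

(** * Treating the first remaining position [i] *)

Section Step.
Variables (P : pred idx) (m : idx -> idx) (d : idx -> bool) (x : idx -> cV).
Hypothesis Px : partial P m d x.
Variable i : idx.
Hypotheses (Pi : ~~ P i) (imin : forall k, ~~ P k -> (i <= k)%N).

Lemma notP_rev k : ~~ P k -> ~~ P (rev_ord k).
Proof.
have [pP _ _ _] := Px; apply: contra => Pr.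
by have [] := pP _ Pr; rewrite rev_ordK.
Qed.

Lemma notP_max k : ~~ P k -> (k <= rev_ord i)%N.
Proof.
by move/notP_rev/imin => /=; have := ltn_ord i; have := ltn_ord k; lia.
Qed.

Definition orthP (y : cV) := forall p, P p -> dot (x p) y = 0.

(** The treated vectors span a [T]-stable space and [T] is anti-selfadjoint, so the orthogonal is
    stable too. *)
Lemma orthPT y : orthP y -> orthP (T *m y).
Proof.
have [pP bP _ _] := Px; move=> yP p Pp; rewrite -[RHS]oppr0.
have [_ Pm _ _ _] := pP _ Pp; have [_ e _] := bP _ Pp.
by apply/eqP; rewrite -eqr_oppLR -dotT e dotZl yP ?mulr0.
Qed.

(* If [k] were in [P], [y] would pair nontrivially with [x (rev k)]. *)
Lemma orthP_lead y k : orthP y -> lead k y -> ~~ P k.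
Proof.
have [pP bP lx _] := Px; move=> yP [ky y0]; apply/negP => Pk.
have [Pr _ _ _ _] := pP _ Pk; have [xr0 xr1] := lx (rev_ord k).
have := yP _ Pr; rewrite (dot_lead xr0) rev_ordK // => /eqP.
by rewrite mulf_eq0 (negPf y0) (negPf xr1).
Qed.

(** The leading position of a nonzero such [y] is untreated, and the untreated positions lie between
    [i] and [rev_ord i]. *)
Lemma orthP_below y : orthP y -> below (rev_ord i) y.
Proof.
move=> yP l il; have [->|y0] := eqVneq y 0; first by rewrite mxE.
have [k ky] := exists_lead y0; have := notP_max (orthP_lead yP ky).
by case: ky => ky _ ki; apply: ky; apply: leq_ltn_trans il.
Qed.

Lemma orthP_min y : orthP y -> (forall l : idx, (i <= l)%N -> y l 0 = 0) -> y = 0.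
Proof.
move=> yP yi; apply/eqP; apply: contraT => y0.
have [k ky] := exists_lead y0; have := imin (orthP_lead yP ky).
by move=> ik; case: ky; rewrite yi ?eqxx.
Qed.

(** Pairing with [x i] reads only the coordinate [rev_ord i] of [y], which is therefore nonzero. *)
Lemma orthP_lead_rev y : orthP y -> dot (x i) y = 1 -> lead (rev_ord i) y.
Proof.
have [_ _ lx _] := Px; move=> yP e; split; first exact: orthP_below.
apply/eqP => y0; move: e; rewrite (dot_lead (lx i).1) ?y0; last exact: orthP_below.
by rewrite mulr0 => /esym/eqP; rewrite oner_eq0.
Qed.

(** Here [x i] is an eigenvector and [i] becomes a sign; its dual vector is chosen in the opposite
    eigenspace, which gives [rev_ord i] the opposite sign. *)
Lemma step_sign : below i (T *m x i) ->
  exists (Q : pred idx) m' d' x', Q i /\ partial (fun k => P k || Q k) m' d' x'.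
Proof.
have [pP bP lx ox] := Px; have [li xi0] := lx i; move=> Tli.
have oi k : ~~ P k -> orthP (x k) by move=> Pk p Pp; rewrite ox.
(* This ratio cancels coordinate [i] of [T *m x i - la *: x i]. The difference then has no
   coordinate from [i] on, so it vanishes by minimality of [i]. *)
pose la := (T *m x i) i 0 / x i i 0.
have Ti : T *m x i = la *: x i.
  apply/eqP; rewrite -subr_eq0; apply/eqP/orthP_min => [p Pp|l].
    by rewrite dotDr dotNr dotZr (orthPT (oi _ Pi)) // oi ?mulr0 ?subrr.
  rewrite leq_eqVlt => /orP[/eqP il|il].
    by rewrite -(val_inj il) /la !mxE divfK ?subrr.
  have := Tli _ il; rewrite !mxE => ->; rewrite li //; ring.
have la2 : la ^+ 2 = 1.
  have := mulTK (x i); rewrite Ti -scalemxAr Ti scalerA => /matrixP/(_ i 0).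
  rewrite mxE => /(canRL (mulfK xi0)); rewrite divff // expr2.
have laT : la = (if la == 1 then 1 else -1).
  by move/eqP: la2; rewrite sqrf_eq1; case: (la =P 1) => //= _ /eqP.
move: la Ti la2 laT => la Ti la2 laT.
have Pri := notP_rev Pi; have [lri ri0] := lx (rev_ord i).
have c0 : dot (x i) (x (rev_ord i)) != 0.
  by rewrite (dot_lead li lri) mulf_neq0.
pose w0 := (dot (x i) (x (rev_ord i)))^-1 *: x (rev_ord i).
have w01 : dot (x i) w0 = 1 by rewrite dotZr mulVf.
have w0P : orthP w0 by move=> p Pp; rewrite dotZr (oi _ Pri _ Pp) mulr0.
move: w0 w01 w0P => w0 w01 w0P.
(* The component of [w0] in the eigenspace for [- la]; its pairing with [x i] is still 1. *)
pose w := 2^-1 *: (w0 - la *: (T *m w0)).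
have wP : orthP w.
  by move=> p Pp; rewrite dotZr dotDr dotNr dotZr w0P // (orthPT w0P) // mulr0 subrr
    mulr0.
have w1 : dot (x i) w = 1.
  have : dot (x i) (T *m w0) = - la.
    by apply/eqP; rewrite -eqr_oppLR -dotT Ti dotZl w01 mulr1.
  rewrite dotZr dotDr dotNr dotZr w01 => ->.
  by rewrite mulrN -expr2 la2 opprK -mulr2n mulVf // pnatr_eq0.
have Tw : T *m w = - la *: w.
  rewrite -scalemxAr mulmxBr -scalemxAr mulTK /w scalerA [- la * _]mulrC -scalerA.
  congr (_ *: _).
  rewrite scalerBr scalerA mulNr -expr2 la2 !scaleNr scale1r opprK addrC //.
have dxx : dot (x i) (x i) = 0.
  have : la * dot (x i) (x i) = 0 by rewrite -dotZr -Ti dotTx.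
  by move/eqP; rewrite mulf_eq0 => /orP[/eqP l0|/eqP//]; move/eqP: la2;
    rewrite l0 expr0n eq_sym oner_eq0.
have dww : dot w w = 0.
  have : - la * dot w w = 0 by rewrite -dotZr -Tw dotTx.
  move/eqP; rewrite mulf_eq0 oppr_eq0 => /orP[/eqP l0|/eqP//].
  by move/eqP: la2; rewrite l0 expr0n eq_sym oner_eq0.
pose y k := if k == i then x i else w.
have [ri ir] : (rev_ord i == i) = false /\ (i == rev_ord i) = false.
  by rewrite (negPf (rev_neq i)) eq_sym (negPf (rev_neq i)).
exists [pred k | (k == i) || (k == rev_ord i)].
have [] := @partial_union P [pred k | (k == i) || (k == rev_ord i)] m d x
  id (fun k => (k == i) == (la == 1)) y Px.
- move=> k /= /orP[]/eqP ->; rewrite ?rev_ordK ?eqxx ?orbT ?ri ?ir; split=> //;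
    split=> //;
    by case: (la == 1).
- move=> k /= /orP[]/eqP ->; rewrite /y /tsign !eqxx ?ri; split=> //.
  + by rewrite Ti {1}laT; case: (la == 1).
  + by move=> q /orP[]/eqP ->; rewrite ?eqxx ?ri ?ir.
  + exact: orthP_lead_rev.
  + by rewrite Tw {1}laT; case: (la == 1); rewrite ?opprK.
  + move=> q /orP[]/eqP ->; rewrite ?eqxx ?ri ?ir rev_ordK ?eqxx ?ri ?ir ?dww //.
    by rewrite dotC w1.
- by move=> q /= /orP[]/eqP ->.
- by move=> p q Pp /= /orP[]/eqP ->; rewrite /y ?eqxx ?ri ?oi ?wP.
move=> m' [d' [x' H]]; exists m', d', x'; split=> //=; by rewrite eqxx.
Qed.

(** The leading position [j] of [T *m x i] is beyond [i] and becomes its mate. The block is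
    completed by [w] dual to [v] and by [z := T *m w] dual to [x i]. *)
Lemma step_pair : ~ below i (T *m x i) ->
  exists (Q : pred idx) m' d' x', Q i /\ partial (fun k => P k || Q k) m' d' x'.
Proof.
have [pP bP lx ox] := Px; have [li xi0] := lx i; move=> Tli.
have oi k : ~~ P k -> orthP (x k) by move=> Pk p Pp; rewrite ox.
have Txi0 : T *m x i != 0.
  by apply: contra_not_neq Tli => -> l _; rewrite mxE.
have oTi := orthPT (oi _ Pi).
have [j [lj j0]] := exists_lead Txi0.
have Pj : ~~ P j by apply: (orthP_lead oTi); split.
have Prj := notP_rev Pj; have Pri := notP_rev Pi.
have ij : (i < j)%N.
  rewrite ltn_neqAle imin // andbT; apply: contra_not_neq Tli => e.
  by move: lj; rewrite -(val_inj e).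
(* A leading position [rev_ord i] would make [x i] pair nontrivially with [T *m x i], against
   [dotTx]. *)
have jri : j != rev_ord i.
  apply: contraNneq j0 => ->; have := dotTx (x i).
  rewrite (dot_lead li); last exact: orthP_below.
  by move/eqP; rewrite mulf_eq0 (negPf xi0).
have irj : (i < rev_ord j)%N.
  rewrite ltn_neqAle imin // andbT; apply: contraNneq jri => e.
  by rewrite (val_inj e) rev_ordK.
have jrj := rev_neq j; have iri := rev_neq i.
have rjri : (rev_ord j < rev_ord i)%N by rewrite ltn_rev2.
(* The minus sign matches [tsign], which is -1 at [i] because [i < rev_ord j]. *)
pose v := - (T *m x i).
have vP : orthP v by move=> p Pp; rewrite dotNr oTi ?oppr0.
have lv : lead j v.
  by split=> [l jl|]; rewrite mxE ?oppr_eq0 // lj ?oppr0.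
have [lrj rj0] := lx (rev_ord j).
have c0 : dot v (x (rev_ord j)) != 0.
  by rewrite (dot_lead lv.1 lrj) mulf_neq0 // lv.2.
pose w0 := (dot v (x (rev_ord j)))^-1 *: x (rev_ord j).
have w01 : dot v w0 = 1 by rewrite dotZr mulVf.
have w0P : orthP w0 by move=> p Pp; rewrite dotZr (oi _ Prj _ Pp) mulr0.
have lw0 : lead (rev_ord j) w0.
  split=> [l jl|]; first by rewrite mxE lrj ?mulr0.
  by rewrite mxE mulf_neq0 // invr_eq0.
have iw0 : dot (x i) w0 = 0 by exact: dot_below li lw0.1 _.
move: w0 w01 w0P lw0 iw0 => w0 w01 w0P lw0 iw0.
have dii : dot (x i) (x i) = 0.
  exact: (dot_below li li (ltn_revl ij irj)).
have div : dot (x i) v = 0 by rewrite dotNr dotTx oppr0.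
have dvv : dot v v = 0 by rewrite dotNl dotT opprK /v mulmxN mulTK dotNr dii oppr0.
(* Adding a multiple of [v] makes [w] isotropic; if [rev j < j] then [tau = 0],
   so [w] keeps its leading position. *)
pose tau := - dot w0 w0 / 2.
pose w := w0 + tau *: v.
have wP : orthP w by move=> p Pp; rewrite dotDr dotZr w0P // vP // mulr0 addr0.
have vw : dot v w = 1 by rewrite dotDr dotZr w01 dvv mulr0 addr0.
have iw : dot (x i) w = 0 by rewrite dotDr dotZr iw0 div mulr0 addr0.
have ww : dot w w = 0.
  rewrite !(dotDr, dotDl, dotZr, dotZl) dvv (dotC w0 v) w01 /tau.
  by field.
have lw : lead (rev_ord j) w.
  have [rjj|jrj'] := ltnP (rev_ord j) j.
    rewrite /w /tau (dot_below lw0.1 lw0.1) ?rev_ordK //.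
    by rewrite oppr0 mul0r scale0r addr0.
  have {}jrj' : (j < rev_ord j)%N by rewrite ltn_neqAle jrj' andbT eq_sym.
  split=> [l jl|]; rewrite /w mxE [X in _ + X]mxE lv.1 ?mulr0 ?addr0 ?lw0.2 //.
    exact: lw0.1.
  exact: ltn_trans jl.
pose z := T *m w.
have zP : orthP z := orthPT wP.
have iz : dot (x i) z = 1 by rewrite -[LHS]opprK -dotT -[T *m x i]opprK dotNl vw opprK.
have lz : lead (rev_ord i) z by exact: orthP_lead_rev.
have vz : dot v z = 0.
  by rewrite dotNl dotT opprK mulTK iw.
have wz : dot w z = 0 by exact: dotTx.
have zz : dot z z = 0 by rewrite dotT mulTK ww oppr0.
pose y k := if k == i then x i else if k == j then v else if k == rev_ord j then w
  else z.
pose m' k := if k == i then j else if k == j then i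
  else if k == rev_ord j then rev_ord i else rev_ord j.
pose Q := [pred k : idx | [|| k == i, k == j, k == rev_ord j | k == rev_ord i]].
have E := rev_distinct ij irj.
exists Q.
have [] := @partial_union P Q m d x m' xpredT y Px.
- move=> k /= /or4P[]/eqP ->; rewrite /m' ?(eqxx, E, rev_ordK, orbT); split=> //;
    split=> // /eqP; by rewrite E.
- move=> k /= kQ; split; [| |move=> q].
  + by case/or4P: kQ => /eqP ->; rewrite /y ?(eqxx, E).
  + have E2 : ((j < rev_ord i)%N) * ((rev_ord j < i)%N = false) *
      ((rev_ord i < j)%N = false).
      do ![apply: pair]; first by rewrite -ltn_rev2 rev_ordK.
        by rewrite ltnNge ltnW.
      by rewrite ltn_revC ltnNge ltnW.
    case/or4P: kQ => /eqP ->; rewrite /y /m' /tsign ?(eqxx, E) ?rev_ordK ?irj ?E2.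
    * by rewrite scaleN1r /v opprK.
    * by rewrite mulmxN mulTK scaleN1r.
    * by rewrite scale1r.
    * by rewrite mulTK scale1r.
  + by case/or4P: kQ => /eqP ->; case/or4P => /eqP ->;
      rewrite /y ?(eqxx, E) ?rev_ordK ?(eqxx, E) //;
    rewrite ?[dot v (x i)]dotC ?[dot w (x i)]dotC ?[dot z (x i)]dotC ?[dot w v]dotC
      ?[dot z v]dotC ?[dot z w]dotC.
- by move=> q /= /or4P[]/eqP ->.
- by move=> p q Pp /= /or4P[]/eqP ->; rewrite /y ?(eqxx, E) ?oi ?wP ?vP ?zP.
move=> m1 [d1 [x1 H]]; exists m1, d1, x1; split=> //=; by rewrite eqxx.
Qed.

End Step.

(** Induction on the number of untreated positions. With no position treated, the standard basis
    qualifies for any matching and signs. *)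
Lemma normal_form : exists m d x, partial predT m d x.
Proof.
suff main k : forall P m d x, (#|predC P| <= k)%N -> partial P m d x ->
    exists m d x, partial predT m d x.
  apply: (main _ pred0 id xpredT (fun k => delta_mx k 0) (leqnn _)).
  split=> // k; split=> [l kl|]; rewrite mxE eqxx andbT ?eqxx ?oner_eq0 //.
  by rewrite -val_eqE gtn_eqF.
(* A union of blocks that exhausts the positions agrees with [predT] only pointwise. *)
have finish (P : pred idx) m d x : (forall k, P k) -> partial P m d x ->
    exists m d x, partial predT m d x.
  move=> allP [a b e f]; exists m, d, x; split=> //.
    by move=> p _; have [] := a p (allP p).
  by move=> p _; have [u v w] := b p (allP p); split=> // q _; apply: w.
elim: k => [|k IH] P m d x cP Px.
  apply: finish Px => k; apply: contraTT cP => Pk; rewrite -ltnNge.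
  by apply/card_gt0P; exists k.
have [/forallP allP|] := boolP [forall k, P k]; first exact: finish Px.
rewrite negb_forall => /existsP[i0 Pi0].
have [i Pi imin] := @arg_minnP _ i0 (fun k => ~~ P k) (fun k => k : nat) Pi0.
have : exists (Q : pred idx) m' d' x', Q i /\ partial (fun k => P k || Q k) m' d' x'.
  have [b|b] := EM (below i (T *m x i)); first exact: step_sign Px _ Pi imin b.
  exact: step_pair Px _ Pi imin b.
move=> [Q [m' [d' [x' [Qi H]]]]]; apply: IH H.
rewrite -ltnS; apply: leq_trans cP; apply: proper_card; apply/properP; split.
  by apply/fintype.subsetP => l; rewrite !inE negb_or => /andP[].
by exists i; rewrite !inE ?Qi ?orbT.
Qed.

End NormalForm.

(** * Clans as signed involutions *)

Section Mate.
Variables (n : nat) (c : clan_string n).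
Notation idx := 'I_(n + n).

(** The default value [i] turns the signs into fixed points, so that a clan becomes an
    involution. *)
Definition mate (i : idx) := odflt i [pick j | matched c i j].

Definition is_plus (i : idx) := c i == plus.

Lemma mate_sign i : ~~ is_number (c i) -> mate i = i.
Proof.
move=> ci; rewrite /mate; case: pickP => // j.
by rewrite /matched (negPf ci) andbF.
Qed.

Hypothesis cc : is_clan c.

Lemma matched_mate i : is_number (c i) -> matched c i (mate i).
Proof.
move=> ci; rewrite /mate; case: pickP => [j //|no].
have := cc.2 i ci; rewrite (cardD1 i) !inE eqxx => /eqP; rewrite eqSS => /eqP c1.
have /card_gt0P[j] : (0 < #|[predD1 [pred j | c j == c i] & i]|)%N by rewrite c1.
rewrite !inE => /andP[ji cj]; have := no j.
by rewrite /matched eq_sym ji ci eq_sym cj.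
Qed.

Lemma mate_fix i : (mate i == i) = ~~ is_number (c i).
Proof.
case: (boolP (is_number (c i))) => [ci|/mate_sign->]; last by rewrite eqxx.
by have /and3P[] := matched_mate ci; rewrite eq_sym => /negbTE.
Qed.

Lemma matchedE i j : matched c i j = (i != j) && (j == mate i).
Proof.
apply/idP/andP => [ij|[ij /eqP e]].
  by rewrite /mate (pick_matched cc ij) /=; case/and3P: ij.
move: ij; rewrite e; have [ci|/mate_sign ->] := boolP (is_number (c i));
  last by rewrite eqxx.
by move=> _; apply: matched_mate.
Qed.

Lemma mateK : involutive mate.
Proof.
move=> i; have [ci|/mate_sign e] := boolP (is_number (c i)); last by rewrite !e.
have := matched_mate ci; rewrite matchedC => m.
by rewrite {1}/mate (pick_matched cc m).
Qed.

Hypothesis cs : clan_eq c (rev_clan (bar_clan c)).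

Lemma plus_rev i : (c (rev_ord i) == plus) = (c i == minus).
Proof.
by have [-> _ _] := cs; rewrite !ffunE rev_ordK; case: (c i) => [[]|].
Qed.

Lemma minus_rev i : (c (rev_ord i) == minus) = (c i == plus).
Proof.
by have [_ -> _] := cs; rewrite !ffunE rev_ordK; case: (c i) => [[]|].
Qed.

Lemma is_number_sign i : is_number (c i) = ~~ ((c i == plus) || (c i == minus)).
Proof. by case: (c i) => [[]|]. Qed.

Lemma number_rev i : is_number (c (rev_ord i)) = is_number (c i).
Proof. by rewrite !is_number_sign plus_rev minus_rev orbC. Qed.

Lemma mate_rev i : mate (rev_ord i) = rev_ord (mate i).
Proof.
have [ci|ci] := boolP (is_number (c i)); last by rewrite !mate_sign ?number_rev.
have m : matched c (rev_ord i) (rev_ord (mate i)).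
  have /and3P[im _ /eqP e] := matched_mate ci.
  have [_ _ ->] := cs; rewrite /matched !ffunE !rev_ordK (inj_eq rev_ord_inj) im e
    eqxx andbT.
  by move: ci; rewrite e; case: (c _).
by rewrite {1}/mate (pick_matched cc m).
Qed.

Hypothesis cd : forall i, is_number (c i) -> c i <> c (rev_ord i).

Lemma clan_paired : paired predT mate is_plus.
Proof.
move=> i _; split=> //; [exact: mateK | exact: mate_rev | split].
  have [ci|/mate_sign->] := boolP (is_number (c i)); last by rewrite eq_sym rev_neq.
  by apply/eqP => e; apply: (cd ci); rewrite -e;
    have /and3P[_ _ /eqP] := matched_mate ci.
move/eqP; rewrite mate_fix is_number_sign /is_plus plus_rev negbK.
by case: (c i) => [[]|].
Qed.

End Mate.

(** * The clan of a signed involution *)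

Section ClanOf.
Variables (n : nat) (m : 'I_(n + n) -> 'I_(n + n)) (d : 'I_(n + n) -> bool).
Notation idx := 'I_(n + n).
Hypothesis P : paired predT m d.

(** The smaller position of a pair serves as its number, so distinct pairs get distinct numbers. *)
Definition clan_of : clan_string n :=
  [ffun i => if m i == i then inl (d i) else inr (minn i (m i))].

Lemma clan_of_number i : is_number (clan_of i) = (m i != i).
Proof. by rewrite ffunE; case: ifP. Qed.

Lemma clan_of_matched i j : matched clan_of i j = (i != j) && (j == m i).
Proof.
have [_ _ mi _ _] := P (isT : predT i); have [_ _ mj _ _] := P (isT : predT j).
rewrite /matched clan_of_number !ffunE; case: (i =P j) => [//|/eqP ij] /=.
have [e|mii] := eqVneq (m i) i; first by rewrite /= e eq_sym (negPf ij).
have [e|mjj] := eqVneq (m j) j; rewrite /=.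
  by apply/esym/eqP => e'; move: ij; rewrite -mi -e' e eqxx.
apply/eqP/eqP => [[]|->]; last by rewrite mi minnC.
move=> e; have : i = j \/ i = m j \/ m i = j \/ m i = m j.
  move: e; rewrite /minn; do 2 case: ifP => _; move/val_inj; tauto.
move=> [e1|[e1|[e1|e1]]] //; first by rewrite e1 eqxx in ij.
  by rewrite e1 mj.
by rewrite -mi e1 mj eqxx in ij.
Qed.

Lemma clan_of_clan : is_clan clan_of.
Proof.
split.
  (* Reversal exchanges the two kinds of signs, so they are equally many. *)
  rewrite -!sum1_card (reindex_inj rev_ord_inj) /=; apply: eq_bigl => i.
  rewrite !inE !ffunE; have [_ _ _ -> [_ e]] := P (isT : predT i).
  rewrite (inj_eq rev_ord_inj); have [/e ->|//] := eqVneq (m i) i.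
  by case: (d i).
move=> i; rewrite clan_of_number => mi.
have -> : #|[pred j | clan_of j == clan_of i]| = #|pred2 i (m i)|.
  apply: eq_card => j; rewrite !inE; have [->|ji] := eqVneq j i; first by rewrite eqxx.
  have := clan_of_matched i j; rewrite /matched clan_of_number mi eq_sym ji /=.
  by rewrite eq_sym.
by rewrite card2 eq_sym mi.
Qed.

Lemma mate_clan_of : mate clan_of = m.
Proof.
apply/funext => i; have := clan_of_matched i (m i); rewrite eqxx andbT => e.
have [mi|mi] := eqVneq (m i) i.
  by rewrite mate_sign ?mi // clan_of_number mi eqxx.
by rewrite /mate (@pick_matched _ _ _ (m i)) // ?e 1?eq_sym //; exact: clan_of_clan.
Qed.

Lemma clan_of_plus i : m i = i -> is_plus clan_of i = d i.
Proof. by rewrite /is_plus ffunE => ->; rewrite eqxx; case: (d i). Qed.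

Lemma clan_of_sym : clan_eq clan_of (rev_clan (bar_clan clan_of)).
Proof.
have r i : clan_of (rev_ord i) = if m i == i then inl (~~ d i) else clan_of (rev_ord i).
  have [mi|//] := eqVneq (m i) i; have [_ _ _ e1 [_ e2]] := P (isT : predT i).
  by rewrite ffunE e1 mi eqxx e2.
have E i : rev_clan (bar_clan clan_of) i = flip (clan_of (rev_ord i)).
  by rewrite /rev_clan ffunE /bar_clan ffunE.
have v i : m i = i -> clan_of i = inl (d i) by move=> mi; rewrite ffunE mi eqxx.
have w i : m i <> i -> clan_of i = inr (minn i (m i)) by move=> /eqP/negPf mi;
  rewrite ffunE mi.
have wr i : m i <> i -> is_number (clan_of (rev_ord i)).
  by move=> mi; rewrite clan_of_number; have [_ _ _ -> _] := P (isT : predT i);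
    rewrite (inj_eq rev_ord_inj); apply/eqP.
split=> [i|i|i j].
- rewrite E; have [mi|/eqP mi] := eqVneq (m i) i; first by rewrite r mi eqxx v //;
    case: (d i).
  by rewrite w //; case: (clan_of (rev_ord i)) (wr _ mi).
- rewrite E; have [mi|/eqP mi] := eqVneq (m i) i; first by rewrite r mi eqxx v //;
    case: (d i).
  by rewrite w //; case: (clan_of (rev_ord i)) (wr _ mi).
have f (x y : symbol) : is_number x && (flip x == flip y) = is_number x && (x == y).
  by case: x => //= x; case: y => [[]|].
have fn (x : symbol) : is_number (flip x) = is_number x by case: x.
rewrite {2}/matched !E fn f.
have -> : (i != j) = (rev_ord i != rev_ord j) by rewrite (inj_eq rev_ord_inj).
have e := clan_of_matched (rev_ord i) (rev_ord j); rewrite /matched in e; rewrite e {e}.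
rewrite clan_of_matched (inj_eq rev_ord_inj); have [_ _ _ -> _] := P (isT : predT i).
by rewrite (inj_eq rev_ord_inj).
Qed.

Lemma clan_of_rev i : is_number (clan_of i) -> clan_of i <> clan_of (rev_ord i).
Proof.
move=> ni e; have := clan_of_matched i (rev_ord i).
rewrite /matched ni e eqxx eq_sym rev_neq /=.
by have [_ _ _ _ [/negPf mi _]] := P (isT : predT i); rewrite eq_sym mi.
Qed.

End ClanOf.

(** * The representative matrices *)

Lemma antidiag_sqr (C : numClosedFieldType) m :
  antidiag_mx C m *m antidiag_mx C m = 1%:M.
Proof.
apply/matrixP => i j; rewrite !mxE (bigD1 (rev_ord i)) //= !mxE eqxx mul1r.
rewrite rev_ordK eq_sym big1 ?addr0 // => k /negPf ki.
by rewrite mxE ki mul0r.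
Qed.

Lemma antidiag_mulE (C : numClosedFieldType) m p (X : 'M[C]_(m, p)) i j :
  (antidiag_mx C m *m X) i j = X (rev_ord i) j.
Proof.
rewrite !mxE (bigD1 (rev_ord i)) //= !mxE eqxx mul1r big1 ?addr0 // => k /negPf ki.
by rewrite mxE ki mul0r.
Qed.

Lemma mul_antidiagE (C : numClosedFieldType) m p (X : 'M[C]_(p, m)) i j :
  (X *m antidiag_mx C m) i j = X i (rev_ord j).
Proof.
rewrite !mxE (bigD1 (rev_ord j)) //= !mxE rev_ordK eqxx mulr1 big1 ?addr0 // => k ki.
by rewrite mxE -(inj_eq rev_ord_inj) rev_ordK eq_sym (negPf ki) mulr0.
Qed.

Lemma antidiag_det_sqr (C : numClosedFieldType) m : \det (antidiag_mx C m) ^+ 2 = 1.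
Proof. by rewrite expr2 -det_mulmx antidiag_sqr det1. Qed.

(** The matrix [K]: its eigenspaces for 1 and -1 are [E_space] and [Et_space], and [pr_E] is
    [(1 + K) / 2]. *)
Definition polar_mx (C : numClosedFieldType) n : 'M[C]_(n + n) :=
  diag_mx (\row_i (if (i < n)%N then 1 else -1)).

(** * Matrices supported on the diagonal and on the graph of an involution *)

Section Mirror.
Variables (C : numClosedFieldType) (n : nat) (m : 'I_(n + n) -> 'I_(n + n)).
Notation idx := 'I_(n + n).
Notation J := (antidiag_mx C (n + n)).

Definition mirror (a b : idx -> C) : 'M[C]_(n + n) :=
  \matrix_(k, i) ((k == m i)%:R * a i + (k == i)%:R * b i).

Lemma mul_mirror p (X : 'M[C]_(p, n + n)) a b k i :
  (X *m mirror a b) k i = X k (m i) * a i + X k i * b i.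
Proof.
rewrite mxE; under eq_bigr do rewrite mxE mulrDr !mulrA.
rewrite big_split /=; congr (_ + _).
  rewrite (bigD1 (m i)) //= eqxx mulr1 big1 ?addr0 // => l /negPf ->.
  by rewrite mulr0 mul0r.
rewrite (bigD1 i) //= eqxx mulr1 big1 ?addr0 // => l /negPf ->.
by rewrite mulr0 mul0r.
Qed.

Hypothesis mK : involutive m.
Hypothesis m_rev : forall i, m (rev_ord i) = rev_ord (m i).

Lemma mirror_eq a b a' b' : a =1 a' -> b =1 b' -> mirror a b = mirror a' b'.
Proof. by move=> ea eb; apply/matrixP => k i; rewrite !mxE ea eb. Qed.

(** On a pair the block is [[[b, a], [a, -b]]], whose square is the scalar [a ^+ 2 + b ^+ 2]. The
    first alternative covers diagonal columns. *)
Lemma mirror_sqr a b :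
  (forall i, (a i = 0 /\ b i ^+ 2 = 1) \/
     [/\ a (m i) = a i, b (m i) = - b i & a i ^+ 2 + b i ^+ 2 = 1]) ->
  mirror a b *m mirror a b = 1%:M.
Proof.
move=> ab; apply/matrixP => k i; rewrite mul_mirror !mxE mK.
case: (ab i) => [[ai bi]|[ai bi e]].
  by rewrite ai !mulr0 !add0r -mulrA -expr2 bi mulr1.
rewrite ai bi -[RHS]mulr1 -e; ring.
Qed.

Lemma mirror_sym a b : (forall i, a (m i) = a i) -> (mirror a b)^T = mirror a b.
Proof.
move=> am; apply/matrixP => k i; rewrite !mxE eq_sym (can2_eq mK mK) [i == k]eq_sym.
have [->//|_] := eqVneq k i.
by rewrite !mul0r !addr0; case: eqP => [->|_]; rewrite ?am ?mul0r.
Qed.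

Lemma mirror_conj a b :
  J *m mirror a b *m J = mirror (a \o @rev_ord _) (b \o @rev_ord _).
Proof.
apply/matrixP => k i; rewrite mul_antidiagE antidiag_mulE !mxE /= m_rev.
by rewrite !(inj_eq rev_ord_inj).
Qed.

End Mirror.

Section Repr.
Variables (C : numClosedFieldType) (n : nat) (c : clan_string n).
Notation idx := 'I_(n + n).
Notation J := (antidiag_mx C (n + n)).
Notation m := (mate c).
Notation d := (is_plus c).
Hypothesis cc : is_clan c.
Hypothesis P : paired predT m d.

Let mK : involutive m := mateK cc.
Let m_rev i : m (rev_ord i) = rev_ord (m i).
Proof. by have [] := P (isT : predT i). Qed.

Lemma signatureE i : signature c i = if m i == i then d i else (m i < i)%N.
Proof.
rewrite /signature mate_fix // /is_plus; case ci : (c i) => [[]|k] //=.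
have ni : is_number (c i) by rewrite ci.
apply/existsP/idP => [[j /andP[ji]]|mi].
  by rewrite matchedC matchedE // => /andP[_ /eqP <-].
by exists (m i); rewrite mi matchedC matched_mate.
Qed.

Lemma mate_rev_neq i : m i != rev_ord i.
Proof. by have [_ _ _ _ []] := P (isT : predT i). Qed.

Lemma ltn_mate i : m i != i -> (m i < i)%N = ~~ (i < m i)%N.
Proof. by move=> mi; rewrite -leqNgt ltn_neqAle mi. Qed.

Lemma signature_rev i : signature c (rev_ord i) = ~~ signature c i.
Proof.
rewrite !signatureE m_rev (inj_eq rev_ord_inj).
have [_ _ _ _ [_ e]] := P (isT : predT i).
case: (m i =P i) => [/e//|/eqP mi]; by rewrite ltn_rev2 ltn_mate // negbK.
Qed.

Lemma rev_half (i : idx) : (rev_ord i < n)%N = ~~ (i < n)%N.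
Proof. by rewrite /= -leqNgt ltn_subLR // addSn ltnS leq_add2r. Qed.

(** The default permutation swaps [i] and [rev_ord i] exactly when the one in the first half has
    signature -. The rule extends to the second half because [rev_ord] exchanges signatures. *)
Lemma default_perm_half i : (default_perm c i < n)%N = signature c i.
Proof.
rewrite permE /default_fun; have [il|il] := boolP (i < n)%N.
  by case: ifP => s; rewrite ?il // rev_half il.
rewrite signature_rev; case: ifP => s; first by rewrite (negPf il) (negPf s).
by rewrite rev_half il (negbFE s).
Qed.

Lemma default_perm_rev i : default_perm c (rev_ord i) = rev_ord (default_perm c i).
Proof.
rewrite !permE /default_fun rev_half rev_ordK if_neg.
by case: (signature c _); rewrite ?rev_ordK.
Qed.

Notation r := ((sqrtC 2)^-1 : C).

Lemma sqrtC2V_sqr : r ^+ 2 = 2^-1. Proof. by rewrite exprVn sqrtCK. Qed.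

(** The coefficients in column [i] of the basis vectors attached to [m i] and to [i]. The test in
    [self_coef] holds for the positions written i and 2n+1-i in assignment (2), and fails for j and
    2n+1-j. *)
Definition mate_coef i : C := if m i == i then 0 else r.
Definition self_coef i : C :=
  if m i == i then 1 else if (i < m i)%N == (i < rev_ord (m i))%N then r else - r.

Notation a := mate_coef.
Notation b := self_coef.

Lemma repr_mx_entry k i : repr_mx C c k i =
  (k == default_perm c (m i))%:R * a i + (k == default_perm c i)%:R * b i.
Proof.
rewrite mxE /repr_vec /mate_coef /self_coef.
case: pickP => [j ij|no] /=.
  have e : mate c i = j by rewrite /mate (pick_matched cc ij).
  rewrite e.
  have -> : (j == i) = false by case/and3P: ij; rewrite eq_sym => /negPf.
  rewrite mxE; case: ifP => _; rewrite !mxE !eqxx !andbT -/r; ring.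
have e : mate c i = i by rewrite /mate; case: pickP => // j; rewrite no.
by rewrite e eqxx !mxE eqxx andbT mulr0 add0r mulr1.
Qed.

Lemma repr_mxE : repr_mx C c = (perm_mx (default_perm c))^T *m mirror m a b.
Proof.
by apply/matrixP => k i; rewrite mul_mirror repr_mx_entry !mxE ![k == _]eq_sym.
Qed.

Lemma mate_coef_mate i : a (m i) = a i.
Proof. by rewrite /mate_coef mK eq_sym. Qed.

Lemma self_coef_mate i : m i != i -> b (m i) = - b i.
Proof.
move=> mi; rewrite /self_coef mK eq_sym (negPf mi) ltn_mate // (ltn_revr (m i)).
by case: (i < m i)%N; case: (i < rev_ord (m i))%N; rewrite ?opprK.
Qed.

Lemma coef_sqr i : m i != i -> a i ^+ 2 + b i ^+ 2 = 1.
Proof.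
move=> mi; rewrite /mate_coef /self_coef (negPf mi).
have -> : (if (i < m i)%N == (i < rev_ord (m i))%N then r else - r) ^+ 2 = r ^+ 2.
  by case: ifP; rewrite ?sqrrN.
by rewrite sqrtC2V_sqr; field.
Qed.

Lemma mate_coef_rev i : a (rev_ord i) = a i.
Proof. by rewrite /mate_coef m_rev (inj_eq rev_ord_inj). Qed.

(** Reversal negates both comparisons in [self_coef], so whether they agree is unchanged. *)
Lemma self_coef_rev i : b (rev_ord i) = b i.
Proof.
rewrite /self_coef m_rev (inj_eq rev_ord_inj) rev_ordK; case: eqP => // /eqP mi.
rewrite ltn_rev2 ltn_mate // ltn_revC.
have -> : (rev_ord (m i) < i)%N = ~~ (i < rev_ord (m i))%N.
  rewrite -leqNgt ltn_neqAle; case: eqP => // /val_inj e.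
  by have := mate_rev_neq i; rewrite -(inj_eq rev_ord_inj) rev_ordK e eqxx.
by case: (i < m i)%N; case: (i < _)%N.
Qed.

Notation M := (mirror m a b).

Lemma mirror_coef_sqr : M *m M = 1%:M.
Proof.
apply: mirror_sqr => // i; have [mi|mi] := eqVneq (m i) i; [left|right].
  by rewrite /mate_coef /self_coef mi eqxx expr1n.
by rewrite mate_coef_mate self_coef_mate // coef_sqr.
Qed.

(** [M] is symmetric, commutes with [J] and squares to 1. *)
Lemma mirror_coef_antidiag : M^T *m J *m M = J.
Proof.
rewrite (mirror_sym mK _ mate_coef_mate).
have e : J *m M *m J = M.
  by rewrite mirror_conj //; apply: mirror_eq => i /=;
    rewrite ?mate_coef_rev ?self_coef_rev.
rewrite -[X in X *m J]e -!mulmxA (mulmxA J J) antidiag_sqr mul1mx mirror_coef_sqr.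
by rewrite mulmx1.
Qed.

Lemma repr_mx_antidiag : (repr_mx C c)^T *m J *m repr_mx C c = J.
Proof.
rewrite repr_mxE trmx_mul trmxK -!mulmxA (mulmxA J) (mulmxA (perm_mx _)).
have -> : perm_mx (default_perm c) *m (J *m (perm_mx (default_perm c))^T) = J.
  apply/matrixP => i j; rewrite -row_permE mxE antidiag_mulE !mxE.
  by rewrite -default_perm_rev (inj_eq perm_inj).
by rewrite mulmxA mirror_coef_antidiag.
Qed.

(** By [default_perm_half] the permuted basis vectors are eigenvectors of [K] with their signatures
    as eigenvalues. The two signatures of a pair are opposite, so [K] exchanges the sum and the
    difference up to sign. *)
Lemma polar_repr_mx k i :
  (polar_mx C n *m repr_mx C c) k i = tsign C m d i * repr_mx C c k (m i).
Proof.
rewrite /polar_mx mul_diag_mx mxE [X in X * _]mxE !repr_mx_entry mK mate_coef_mate.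
have h x : (if (k < n)%N then 1 else -1) * (k == default_perm c x)%:R =
    (k == default_perm c x)%:R * (if signature c x then 1 else -1) :> C.
  by have [->|_] := eqVneq k (default_perm c x);
    rewrite ?default_perm_half ?mulr0 ?mul0r // mulrC.
rewrite mulrDr !mulrA !h mulrDr.
have [mi|mi] := eqVneq (m i) i.
  by rewrite /tsign /mate_coef /self_coef mi eqxx signatureE mi eqxx; ring.
rewrite self_coef_mate // !signatureE mK (eq_sym i) (negPf mi) ltn_mate // /tsign
  /mate_coef /self_coef (negPf mi).
by case: (i < m i)%N; case: (i < rev_ord (m i))%N => /=; ring.
Qed.

End Repr.

(** * Determinant of the representatives *)

Section Counting.
Variables (n : nat) (c : clan_string n).
Notation idx := 'I_(n + n).
Notation m := (mate c).
Hypothesis cc : is_clan c.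

Lemma num_pairs_mate k : num_pairs c k = #|[pred i : idx | (i < k)%N && (m i < i)%N]|.
Proof.
have inj : injective (fun i : idx => (m i, i)) by move=> i j [].
rewrite -(fintype.card_image inj); apply: eq_card => -[s t]; rewrite !inE /=.
apply/idP/fintype.imageP => [/and3P[st tk +]| [i +]].
  rewrite matchedC matchedE // => /andP[_ /eqP e].
  by exists t; rewrite ?inE -?e ?tk.
rewrite inE => /andP[ik mi] [-> ->]; rewrite mi ik matchedC matchedE // eqxx andbT.
by rewrite -val_eqE gtn_eqF.
Qed.

Lemma num_straddling_mate i j : num_straddling c i j =
  #|[pred t : idx | [&& (j <= t)%N, m t != t & (m t < i)%N]]|.
Proof.
have inj : injective (fun i : idx => (m i, i)) by move=> x y [].
rewrite -(fintype.card_image inj); apply: eq_card => -[s t]; rewrite !inE /=.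
apply/idP/fintype.imageP => [/and3P[si jt +]| [u +]].
  rewrite matchedC matchedE // => /andP[ts /eqP e].
  by exists t; rewrite ?inE -?e ?jt ?si 1?eq_sym ?ts.
rewrite inE => /and3P[ju mu mi] [-> ->]; rewrite mi ju matchedC matchedE // eqxx andbT.
by rewrite eq_sym.
Qed.

End Counting.

(** A fixed-point-free involution forces even cardinality; [lt] selects one member of each orbit. *)
Lemma odd_invol (T : finType) (S : pred T) (f : T -> T) (lt : rel T) :
  {in S, involutive f} -> (forall x, S x -> S (f x)) ->
  (forall x, S x -> lt (f x) x = ~~ lt x (f x)) -> ~~ odd #|S|.
Proof.
move=> fK Sf ltf; rewrite -(cardID [pred x | lt x (f x)] S).
rewrite -[X in (_ + X)%N](_ : #|[predI S & [pred x | lt x (f x)]]| = _).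
  by rewrite addnn odd_double.
have inj : {in [predI S & [pred x | lt x (f x)]] &, injective f}.
  by move=> x y /andP[Sx _] /andP[Sy _] e; rewrite -(fK x) // -(fK y) // e.
rewrite -(fintype.card_in_image inj); apply: eq_card => y; rewrite !inE.
apply/fintype.imageP/andP => [[x /andP[Sx ltx] ->]| [lty Sy]].
  by split; last exact: Sf; rewrite fK // ltf // negbK.
exists (f y); last by rewrite fK.
by apply/andP; split; [exact: Sf | rewrite inE fK // ltf].
Qed.

Section Det.
Variables (C : numClosedFieldType) (n : nat) (c : clan_string n).
Notation idx := 'I_(n + n).
Notation J := (antidiag_mx C (n + n)).
Notation m := (mate c).
Notation d := (is_plus c).
Hypothesis cc : is_clan c.
Hypothesis P : paired predT m d.

Let mK : involutive m := mateK cc.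
Let m_rev i : m (rev_ord i) = rev_ord (m i).
Proof. by have [] := P (isT : predT i). Qed.

Lemma odd_default_perm :
  odd_perm (default_perm c) = odd #|[pred i : idx | (i < n)%N && ~~ signature c i]|.
Proof.
(* The default permutation is a product of transpositions of [i] and [rev_ord i], which are disjoint
   because the list stays in the first half. *)
have prodE (s : seq idx) : uniq s -> {in s, forall i : idx, (i < n)%N} ->
    odd_perm (\prod_(i <- s) tperm i (rev_ord i))%g = odd (size s) /\
    forall i, (\prod_(i <- s) tperm i (rev_ord i))%g i =
      if (i \in s) || (rev_ord i \in s) then rev_ord i else i.
  elim: s => [|x s IH] /=; first by rewrite big_nil odd_perm1; split=> // i;
    rewrite perm1.
  move=> /andP[xs us] sn; have {}sn' : {in s, forall i : idx, (i < n)%N}.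
    by move=> i si; apply: sn; rewrite inE si orbT.
  have xn : (x < n)%N by apply: sn; rewrite inE eqxx.
  have rxs : rev_ord x \notin s.
    by apply/negP => /sn'; rewrite rev_half xn.
  have [o e] := IH us sn'; rewrite big_cons; split.
    by rewrite odd_permM odd_tperm o eq_sym rev_neq.
  move=> i; rewrite permM e !inE; case: tpermP => [->|->|/eqP ix /eqP irx].
  - by rewrite eqxx rev_ordK (negPf rxs) (negPf xs).
  - by rewrite rev_ordK (negPf xs) (negPf rxs) eqxx orbT.
  rewrite (negPf ix) -[rev_ord i == x](inj_eq rev_ord_inj) rev_ordK (negPf irx) //.
have [||o e] := prodE (enum [pred i : idx | (i < n)%N && ~~ signature c i]).
- exact: enum_uniq.
- by move=> i; rewrite mem_enum inE => /andP[].
rewrite cardE -o; congr (odd_perm _); apply/permP => i; rewrite e permE /default_fun.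
rewrite !mem_enum !inE rev_half; have [il|il] := boolP (i < n)%N => /=.
  by rewrite orbF; case: (signature c i).
by case: (signature c _).
Qed.

(** Signature - in the first half occurs at the signs -, at the openings of pairs closed there, and
    at the openings of pairs crossing the middle. The last set has even size: [i |-> rev_ord (m i)]
    acts on it without fixed points. *)
Lemma odd_minus_signature :
  odd #|[pred i : idx | (i < n)%N && ~~ signature c i]| =
  odd (num_minus c n + num_pairs c n).
Proof.
pose S := [pred i : idx | [&& (i < n)%N, m i != i & (n <= m i)%N]].
have Se : ~~ odd #|S|.
  apply: (@odd_invol _ _ (fun i => rev_ord (m i)) (fun i j : idx => (i < j)%N)).
  - by move=> i _; rewrite m_rev rev_ordK mK.
  - move=> i /and3P[il mi nm]; rewrite /= m_rev mK (inj_eq rev_ord_inj) eq_sym mi.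
    by rewrite rev_half -leqNgt nm leqNgt rev_half negbK.
  move=> i _; rewrite -leqNgt ltn_neqAle; case: eqP => [/val_inj e|//].
  by have := mate_rev_neq P i; rewrite -(inj_eq rev_ord_inj) rev_ordK e eqxx.
have -> : #|[pred i : idx | (i < n)%N && ~~ signature c i]| =
    (num_minus c n + num_pairs c n + #|S|)%N.
  (* [m] carries the closing positions in the first half to the openings of the same pairs. *)
  rewrite num_pairs_mate // -[#|[pred i | _ && (m i < i)%N]|](_ :
    #|[pred i : idx | (i < n)%N && [&& m i != i, (i < m i)%N & (m i < n)%N]]| = _);
      last first.
    have mi : injective m by exact: (inv_inj mK).
    rewrite -(fintype.card_image mi); apply: eq_card => y; rewrite !inE.
    apply/fintype.imageP/andP => [[x +] | [yn ym]].
      by rewrite inE => /and4P[xn mx xm mn] ->; rewrite mK.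
    exists (m y); last by rewrite mK.
    by rewrite inE mK (ltn_trans ym yn) ym yn -val_eqE gtn_eqF.
  rewrite /num_minus -!sum1_card [LHS]big_mkcond /=.
  rewrite [X in (X + _ + _)%N]big_mkcond [X in (_ + X + _)%N]big_mkcond.
  rewrite [X in (_ + _ + X)%N]big_mkcond -!big_split /=.
  apply: eq_bigr => i _; rewrite !inE signatureE // mate_fix // is_number_sign /is_plus.
  have [il|//] := boolP (i < n)%N.
  case ci: (c i) => [[]|k] //=.
  have mi : m i != i by rewrite mate_fix // ci.
  rewrite (ltn_mate mi) negbK; have [im|] := ltnP i (m i); first by case: ltnP.
  by rewrite leq_eqVlt val_eqE (negPf mi) /= => mi'; rewrite leqNgt (ltn_trans mi' il).
by rewrite oddD (negPf Se) addbF.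
Qed.

(** The sign comes from the default permutation alone; the mirror factor has determinant 1. *)
Lemma det_repr_mx : \det (repr_mx C c) = (-1) ^+ (num_minus c n + num_pairs c n).
Proof.
rewrite (repr_mxE C cc) det_mulmx det_tr det_perm odd_default_perm odd_minus_signature
  signr_odd.
pose a := mate_coef C c; pose b := self_coef C c.
(* The matched pairs come in couples exchanged by [rev]; treating one pair of each
   couple gives an involution [X] with [X * (J X J) = M], so [\det M = \det X ^+ 2]. *)
pose top (i : idx) := (minn i (m i) < minn (rev_ord i) (rev_ord (m i)))%N.
have topm i : top (m i) = top i by rewrite /top mK minnC (minnC (rev_ord (m i))).
have topr i : m i != i -> top (rev_ord i) = ~~ top i.
  move=> mi; rewrite /top m_rev !rev_ordK -leqNgt ltn_neqAle.
  case: eqP => // e; have : i = rev_ord i \/ i = rev_ord (m i) \/ m i = rev_ord i \/ m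
    i = rev_ord (m i).
    move: e; rewrite /minn; do 2 case: ifP => _; move/val_inj => e; rewrite e; tauto.
  have := rev_neq i; have := rev_neq (m i); have := mate_rev_neq P i.
  move=> /eqP h1 /eqP h2 /eqP h3 [h|[h|[h|h]]];
    [case: h3|case: h1|case: h1|case: h2] => //.
  by rewrite [in RHS]h rev_ordK.
pose X := mirror m (fun i => if top i then a i else 0) (fun i => if top i then b i
  else 1).
have aE i : m i = i -> a i = 0 by rewrite /a /mate_coef => ->; rewrite eqxx.
have bE i : m i = i -> b i = 1 by rewrite /b /self_coef => ->; rewrite eqxx.
have XX : X *m X = 1%:M.
  apply: mirror_sqr => // i; rewrite topm.
  have [mi|mi] := eqVneq (m i) i; first by left; rewrite aE // bE // !if_same expr1n.
  case: (top i); [right|by left; rewrite expr1n].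
  by rewrite /a /b mate_coef_mate // self_coef_mate // coef_sqr.
have XM : X *m (J *m X *m J) = mirror m a b.
  rewrite mirror_conj //; apply/matrixP => k i; rewrite mul_mirror !mxE /= mK.
  have [mi|mi] := eqVneq (m i) i.
    rewrite !(aE, bE, if_same) ?m_rev ?mi //; ring.
  rewrite topm topr // /a /b mate_coef_rev // self_coef_rev //.
  by case: (top i) => /=; ring.
have dX : \det X ^+ 2 = 1 by rewrite expr2 -det_mulmx XX det1.
rewrite -XM !det_mulmx; have dJ := antidiag_det_sqr C (n + n).
transitivity ((-1) ^+ (num_minus c n + num_pairs c n) * (\det X ^+ 2 * \det J ^+ 2));
  first by ring.
by rewrite dX dJ !mulr1.
Qed.

End Det.

(** * Dimensions attached to a flag *)

Section Spaces.
Variables (C : numClosedFieldType) (n : nat).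
Notation idx := 'I_(n + n).
Notation cV := 'cV[C]_(n + n).
Notation K := (polar_mx C n).

(** The [b i] are dual to the coordinates of [h *m x] indexed by [S], hence free. They span [W]
    because a vector minus its expansion has all these coordinates zero. *)
Lemma dimv_coord (W : {vspace cV}) (h : 'M[C]_(n + n)) (S : pred idx) (b : idx -> cV) :
  (forall i j, S i -> S j -> (h *m b j) i 0 = (i == j)%:R) ->
  (forall i, S i -> b i \in W) ->
  (forall x, x \in W -> (forall i, S i -> (h *m x) i 0 = 0) -> x = 0) ->
  \dim W = #|S|.
Proof.
move=> hb bW W0; pose X := [tuple b (enum_val k) | k < #|S|].
have Sv (k : 'I_#|S|) : S (enum_val k) by have := enum_valP k.
have XE (k : 'I_#|S|) : [seq b (enum_val l) | l <- enum 'I_#|S|]`_k = b (enum_val k).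
  by rewrite (nth_map k) ?size_enum_ord // nth_ord_enum.
have fX : free X.
  apply/freeP => k k0 i.
  have := congr1 (fun x => (h *m x) (enum_val i) 0) k0.
  rewrite mulmx0 [RHS]mxE mulmx_sumr summxE (bigD1 i) //= big1 ?addr0.
    by rewrite -scalemxAr mxE XE hb // eqxx mulr1.
  move=> j ji; rewrite -scalemxAr mxE XE hb //.
  by rewrite (inj_eq enum_val_inj) eq_sym (negPf ji) mulr0.
suff -> : W = <<X>>%VS by rewrite (eqP fX) size_tuple.
apply/eqP; rewrite eqEsubv; apply/andP; split; last first.
  by apply/span_subvP => x /mapP[k _ ->]; apply: bW.
have bX i : S i -> b i \in <<X>>%VS.
  move=> Si; apply/memv_span/mapP; exists (enum_rank_in Si i);
    first by rewrite mem_enum.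
  by rewrite enum_rankK_in.
apply/subvP => x xW; pose y := \sum_(i | S i) (h *m x) i 0 *: b i.
have yX : y \in <<X>>%VS by apply: memv_suml => i Si; rewrite memvZ ?bX.
have yW : y \in W by apply: memv_suml => i Si; rewrite memvZ ?bW.
suff -> : x = y by [].
apply/eqP; rewrite -subr_eq0; apply/eqP/W0; first by rewrite memvB.
move=> i Si; rewrite mulmxBr mxE [X in _ + X]mxE mulmx_sumr summxE (bigD1 i) //= big1
  ?addr0.
  by rewrite -scalemxAr [X in _ - X]mxE hb // eqxx mulr1 subrr.
by move=> j /andP[Sj ji]; rewrite -scalemxAr mxE hb // eq_sym (negPf ji) mulr0.
Qed.

Lemma mem_span_std (S : pred idx) (v : cV) :
  reflect (forall i, ~~ S i -> v i 0 = 0) (v \in <<[seq std_vec C i | i in S]>>%VS).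
Proof.
apply: (iffP idP) => [vS i Si|v0].
  pose phi := linfun (row i : cV -> 'cV[C]_1).
  have : (<<[seq std_vec C j | j in S]>> <= lker phi)%VS.
    apply/span_subvP => w /mapP[j]; rewrite mem_enum => Sj ->.
    rewrite memv_ker lfunE; apply/eqP/matrixP => a b; rewrite !mxE.
    by case: eqP Si => // ->; rewrite (Sj : S j).
  move/subvP/(_ v vS); rewrite memv_ker lfunE => /eqP/matrixP/(_ 0 0).
  by rewrite !mxE.
rewrite (matrix_sum_delta v); apply: memv_suml => i _; rewrite big_ord1.
have [Si|Si] := boolP (S i); last by rewrite v0 // scale0r mem0v.
by apply/memvZ/memv_span/mapP; exists i; first by rewrite mem_enum.
Qed.

Lemma polar_mulE p (x : 'M[C]_(n + n, p)) k j :
  (K *m x) k j = if (k < n)%N then x k j else - x k j.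
Proof. by rewrite /polar_mx mul_diag_mx !mxE; case: ifP; rewrite ?mul1r ?mulN1r. Qed.

Lemma self_opp_eq0 (x : C) : x = - x -> x = 0.
Proof. by move/eqP; rewrite -addr_eq0 -mulr2n mulrn_eq0 /= => /eqP. Qed.

Lemma mem_E_space v : v \in E_space C n <-> K *m v = v.
Proof.
split=> [/mem_span_std v0|Kv].
  apply/matrixP => i j; rewrite polar_mulE ord1; case: ifPn => // ni.
  by rewrite v0 ?oppr0.
apply/mem_span_std => i /= /negPf ni; have := congr1 (fun x : cV => x i 0) Kv.
by rewrite /= polar_mulE ni => /esym/self_opp_eq0.
Qed.

Lemma mem_Et_space v : v \in Et_space C n <-> K *m v = - v.
Proof.
split=> [/mem_span_std v0|Kv].
  apply/matrixP => i j; rewrite polar_mulE mxE ord1; case: ifPn => // ni.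
  by rewrite v0 ?oppr0 //= -ltnNge.
apply/mem_span_std => i /=; rewrite -ltnNge => ni.
have := congr1 (fun x : cV => x i 0) Kv.
by rewrite /= polar_mulE ni mxE => /self_opp_eq0.
Qed.

Lemma pr_E_polar (v : cV) : pr_E C n v = 2^-1 *: (v + K *m v).
Proof.
rewrite lfunE /=; apply/matrixP => i j; rewrite !mxE (bigD1 i) //= !mxE eqxx /=.
rewrite big1 ?addr0; last by move=> k; rewrite -val_eqE eq_sym => /negPf ki;
  rewrite mxE ki mul0r.
have := polar_mulE v i j; rewrite mxE => ->.
by case: ifP => _ /=; field.
Qed.

Lemma polar_sqr : K *m K = 1%:M.
Proof.
apply/matrixP => i j; rewrite polar_mulE /polar_mx !mxE.
by case: eqP => [->|_]; case: ifP => ->; rewrite ?mulr1n ?mulr0n ?opprK ?oppr0.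
Qed.

Lemma polar_antidiag : K^T *m antidiag_mx C (n + n) = - (antidiag_mx C (n + n) *m K).
Proof.
have -> : K^T = K by rewrite tr_diag_mx.
apply/matrixP => i j; rewrite polar_mulE [RHS]mxE /polar_mx mul_mx_diag !mxE.
have [->|_] := eqVneq j (rev_ord i); last by rewrite mul0r oppr0 if_same.
by rewrite rev_half mul1r; case: (i < n)%N; rewrite ?opprK.
Qed.

Lemma mem_flag (g : 'M[C]_(n + n)) (k : 'I_(n + n).+1) v : g \in unitmx ->
  v \in flag_of_mx g k <-> forall i : idx, (k <= i)%N -> (invmx g *m v) i 0 = 0.
Proof.
move=> gu; rewrite -[g in flag_of_mx g]mulmx1 -act_flag_of_mx ffunE.
split=> [/memv_imgP[w wk ->]|/mem_flag1 wk].
  by rewrite lfunE /= mulKmx //; apply/mem_flag1.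
apply/memv_imgP; exists (invmx g *m v) => //.
by rewrite lfunE /= mulKVmx.
Qed.

End Spaces.

(** * Dimensions for a flag whose basis [K] permutes up to sign *)

Section OrbitDims.
Variables (C : numClosedFieldType) (n : nat) (c : clan_string n).
Notation idx := 'I_(n + n).
Notation cV := 'cV[C]_(n + n).
Notation K := (polar_mx C n).
Notation m := (mate c).
Notation d := (is_plus c).
Notation t := (tsign C m d).
Hypothesis cc : is_clan c.
Hypothesis P : paired predT m d.
Variable g : 'M[C]_(n + n).
Hypothesis gu : g \in unitmx.
Hypothesis Kg : forall k i, (K *m g) k i = t i * g k (m i).

Let mK : involutive m := mateK cc.

Lemma tsign_mate i : t (m i) = t i.
Proof.
rewrite /tsign mK eq_sym; have [->//|mi] := eqVneq (m i) i.
by rewrite ltn_revr.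
Qed.

Lemma tsign_sqr i : t i * t i = 1.
Proof. by rewrite /tsign; do !case: ifP => _; rewrite ?mulrNN mulr1. Qed.

Lemma coord_polar (x : cV) i :
  (invmx g *m (K *m x)) i 0 = t i * (invmx g *m x) (m i) 0.
Proof.
have e : K *m g = g *m mirror m t (fun=> 0).
  by apply/matrixP => k j; rewrite Kg mul_mirror mulr0 addr0 mulrC.
rewrite -{1}[x](mulKVmx gu) (mulmxA K) e -mulmxA mulKmx // mxE.
rewrite (bigD1 (m i)) //= big1 ?addr0 => [|k ki].
  by rewrite mxE mK eqxx mulr0 addr0 mul1r tsign_mate.
by rewrite mxE mulr0 addr0 eq_sym (can2_eq mK mK) (negPf ki) !mul0r.
Qed.

Lemma coord_col i j : (invmx g *m col j g) i 0 = (i == j)%:R.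
Proof. by rewrite colE mulmxA mulVmx // mul1mx !mxE eqxx andbT. Qed.

Lemma coord_eq0 (x : cV) : (forall i, (invmx g *m x) i 0 = 0) -> x = 0.
Proof.
move=> x0; rewrite -[x](mulKVmx gu) (_ : invmx g *m x = 0) ?mulmx0 //.
by apply/matrixP => i j; rewrite ord1 x0 mxE.
Qed.

Lemma polar_col i : K *m col i g = t i *: col (m i) g.
Proof. by apply/matrixP => k j; rewrite colE mulmxA -colE [LHS]mxE Kg !mxE. Qed.

Lemma dim_flag_polar (e : C) (F : {vspace cV}) (k : 'I_(n + n).+1) : e * e = 1 ->
  (forall v, v \in F <-> K *m v = e *: v) ->
  \dim (flag_of_mx g k :&: F)%VS =
    #|[pred i : idx | (i < k)%N && (if m i == i then t i == e else (m i < i)%N)]|.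
Proof.
move=> ee FP.
have e0 : e != 0 by apply/eqP => e0; move: ee; rewrite e0 mul0r => /esym/eqP;
  rewrite oner_eq0.
(* Each pair spans one eigenvector for [e]; indexed by its closing position, it lies in the flag
   step as soon as the pair is complete. *)
pose b i := if m i == i then col i g else col i g + (e * t i) *: col (m i) g.
apply: (@dimv_coord _ _ _ (invmx g) _ b).
- move=> i j /andP[_ Si] /andP[_ Sj]; rewrite /b; case: ifPn => mj;
    first exact: coord_col.
  rewrite mulmxDr mxE coord_col -scalemxAr mxE coord_col.
  have -> : (i == m j) = false; last by rewrite mulr0 addr0.
  apply/eqP => ij; move: Si Sj; rewrite (negPf mj) ij mK eq_sym (negPf mj).
  by case: ltngtP.
- move=> i /andP[ik Si]; rewrite memv_cap; apply/andP; split.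
    apply/mem_flag => // l kl; rewrite /b; case: ifPn Si => mi Si.
      by rewrite coord_col -val_eqE gtn_eqF ?(leq_trans ik).
    rewrite mulmxDr mxE coord_col -scalemxAr mxE coord_col -!val_eqE /= !gtn_eqF
      ?mulr0 ?addr0 //.
      exact: ltn_trans Si (leq_trans ik kl).
    exact: leq_trans ik kl.
  apply/FP; rewrite /b; case: ifPn Si => mi; first by move/eqP => <-;
    rewrite polar_col (eqP mi).
  move=> _; rewrite mulmxDr -scalemxAr !polar_col mK tsign_mate scalerDr !scalerA.
  by rewrite -mulrA tsign_sqr mulr1 addrC mulrA ee mul1r.
move=> x; rewrite memv_cap => /andP[/mem_flag-/(_ gu) xk /FP Kx] xS.
have xm i : e * (invmx g *m x) i 0 = t i * (invmx g *m x) (m i) 0.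
  by rewrite -coord_polar Kx -scalemxAr [RHS]mxE.
have xm0 i : (invmx g *m x) (m i) 0 = 0 -> (invmx g *m x) i 0 = 0.
  by move=> h; have := xm i; rewrite h mulr0 => /eqP;
    rewrite mulf_eq0 (negPf e0) => /eqP.
apply: coord_eq0 => i; have [ki|ik] := leqP k i; first exact: xk.
have [mi|mi] := eqVneq (m i) i.
  have [te|te] := eqVneq (t i) e; first by apply: xS; rewrite /= ik mi eqxx te eqxx.
  have := xm i; rewrite mi => /eqP; rewrite -subr_eq0 -mulrBl mulf_eq0 subr_eq0.
  by rewrite eq_sym (negPf te) => /eqP.
(* At an opening position the vanishing is inherited from the mate, which closes either before [k],
   within the index set, or in the range where all coordinates vanish. *)
have [lim|lmi] := ltnP i (m i); last first.
  by apply: xS; rewrite /= ik (negPf mi) ltn_neqAle lmi andbT.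
apply: xm0; have [kmi|mik] := leqP k (m i); first exact: xk.
by apply: xS; rewrite /= mik mK eq_sym (negPf mi).
Qed.

Lemma card_polar_basis (s : bool) (k : nat) :
  #|[pred i : idx | (i < k)%N &&
      (if m i == i then t i == (if s then 1 else -1) else (m i < i)%N)]| =
  (#|[pred i : idx | (i < k)%N && (c i == inl s)]| + num_pairs c k)%N.
Proof.
rewrite num_pairs_mate // -!sum1_card [LHS]big_mkcond /=.
rewrite [X in _ = (X + _)%N]big_mkcond [X in _ = (_ + X)%N]big_mkcond -big_split /=.
apply: eq_bigr => i _; rewrite !inE; case: (i < k)%N => //=.
rewrite /tsign mate_fix // /is_plus.
have N1 : (-1 == 1 :> C) = false by apply/eqP => /esym/self_opp_eq0/eqP;
  rewrite oner_eq0.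
case ci: (c i) => [s'|k'] /=; last by case: ifP.
have -> : m i = i by rewrite mate_sign // ci.
rewrite ltnn addn0 /plus {ci}.
have -> : (@inl bool nat s' == inl true) = s' by case: s'.
have -> : (@inl bool nat s' == inl s) = (s' == s) by [].
by case: s'; case: s; rewrite ?eqxx ?N1 // eq_sym N1.
Qed.

Lemma dim_flag_E (k : 'I_(n + n).+1) :
  \dim (flag_of_mx g k :&: E_space C n)%VS = (num_plus c k + num_pairs c k)%N.
Proof.
rewrite (@dim_flag_polar 1) ?mulr1 //; first exact: (card_polar_basis true).
by move=> v; rewrite scale1r; exact: mem_E_space.
Qed.

Lemma dim_flag_Et (k : 'I_(n + n).+1) :
  \dim (flag_of_mx g k :&: Et_space C n)%VS = (num_minus c k + num_pairs c k)%N.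
Proof.
rewrite (@dim_flag_polar (-1)) ?mulrNN ?mulr1 //; first exact: (card_polar_basis false).
by move=> v; rewrite scaleN1r; exact: mem_Et_space.
Qed.

(** Besides the first [j] columns, the sum contains column [l] whenever [m l < i] and [m l != l],
    because projecting column [m l] adds a multiple of column [l]. *)
Lemma dim_flag_pr (i j : 'I_(n + n).+1) : (i < j)%N ->
  \dim (pr_E C n @: flag_of_mx g i + flag_of_mx g j)%VS = (j + num_straddling c i j)%N.
Proof.
move=> ij; rewrite num_straddling_mate //.
pose S := [pred l : idx | (l < j)%N || ((m l != l) && (m l < i)%N)].
have colk (l : idx) (k : 'I_(n + n).+1) : (l < k)%N -> col l g \in flag_of_mx g k.
  move=> lk; apply/mem_flag => // p kp.
  by rewrite coord_col -val_eqE gtn_eqF ?(leq_trans lk).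
rewrite (@dimv_coord _ _ _ (invmx g) S (fun l => col l g)).
- have cj : (j : nat) = #|[pred l : idx | (l < j)%N]|.
    rewrite -[LHS]card_ord -!sum1_card (big_ord_widen (n + n) (fun=> 1%N)) //.
    by rewrite -ltnS.
  rewrite [X in _ = (X + _)%N]cj -!sum1_card [LHS]big_mkcond /=.
  rewrite [X in _ = (X + _)%N]big_mkcond [X in _ = (_ + X)%N]big_mkcond.
  rewrite -big_split /=; apply: eq_bigr => l _; rewrite !inE (leqNgt j).
  by case: (l < j)%N.
- by move=> k l _ _; rewrite coord_col.
- move=> l Sl; have [lj|jl] := ltnP l j.
    by rewrite -[col l g]add0r memv_add ?mem0v ?colk.
  move: Sl; rewrite /= ltnNge jl /= => /andP[ml mli].
  have pml : pr_E C n (col (m l) g) \in (pr_E C n @: flag_of_mx g i)%VS.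
    by rewrite memv_img ?colk.
  have -> : col l g = (2 * t l) *: pr_E C n (col (m l) g) + (- t l) *: col (m l) g.
    rewrite pr_E_polar polar_col mK tsign_mate !scalerDr !scalerA.
    have -> : 2 * t l * 2^-1 = t l by field.
    by rewrite tsign_sqr scale1r scaleNr addrAC subrr add0r.
  by rewrite memv_add ?memvZ // colk // (ltn_trans mli).
move=> x /memv_addP[_ /memv_imgP[y yi ->] [z zj ->]] xS.
apply: coord_eq0 => l; have [lS|] := boolP (S l); first exact: xS.
rewrite /= negb_or -leqNgt => /andP[jl]; rewrite negb_and negbK => mli.
have il : (i <= l)%N by rewrite (leq_trans (ltnW ij)).
move/mem_flag: yi => /(_ gu) yi; move/mem_flag: zj => /(_ gu) zj.
rewrite mulmxDr mxE (zj _ jl) addr0 pr_E_polar -scalemxAr mxE mulmxDr mxE (yi _ il)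
  add0r.
rewrite coord_polar (yi (m l)) ?mulr0 //.
by case/orP: mli => [/eqP->//|]; rewrite -leqNgt.
Qed.

End OrbitDims.

(** * Recovering the clan from the dimensions *)

Lemma card_prefixS N (A : pred 'I_N) (k : 'I_N) :
  #|[pred i : 'I_N | (i < k.+1)%N && A i]| =
  (A k + #|[pred i : 'I_N | (i < k)%N && A i]|)%N.
Proof.
rewrite (cardD1 k) !inE ltnSn; congr (_ + _)%N; apply: eq_card => i; rewrite !inE.
by rewrite ltnS ltn_neqAle val_eqE andbA.
Qed.

Lemma card_suffixS N (A : pred 'I_N) (k : 'I_N) :
  #|[pred i : 'I_N | (k <= i)%N && A i]| =
  (A k + #|[pred i : 'I_N | (k.+1 <= i)%N && A i]|)%N.
Proof.
rewrite (cardD1 k) !inE leqnn; congr (_ + _)%N; apply: eq_card => i; rewrite !inE.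
by rewrite ltn_neqAle val_eqE andbA (eq_sym k).
Qed.

Section Separation.
Variable n : nat.
Notation idx := 'I_(n + n).

Variables c d : clan_string n.
Hypotheses (cc : is_clan c) (dc : is_clan d).
Hypothesis plus_eq : forall k : 'I_(n + n).+1,
  (num_plus c k + num_pairs c k = num_plus d k + num_pairs d k)%N.
Hypothesis minus_eq : forall k : 'I_(n + n).+1,
  (num_minus c k + num_pairs c k = num_minus d k + num_pairs d k)%N.
Hypothesis straddling_eq : forall i j : 'I_(n + n).+1, (i < j)%N ->
  num_straddling c i j = num_straddling d i j.

Lemma mate_lt_number (e : clan_string n) (i : idx) : (mate e i < i)%N -> is_number (e
  i).
Proof. by move=> h; apply: contraTT h => /mate_sign ->; rewrite ltnn. Qed.

(** The increments of the two counts at [i] are (1, 0) for a +, (0, 1) for a -, (1, 1) for a closing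
    position and (0, 0) for an opening one. *)
Lemma separation_type (i : idx) :
  [/\ (c i == plus) = (d i == plus), (c i == minus) = (d i == minus) &
      (mate c i < i)%N = (mate d i < i)%N].
Proof.
have := plus_eq (lift ord0 i); have := plus_eq (widen_ord (leqnSn _) i).
have := minus_eq (lift ord0 i); have := minus_eq (widen_ord (leqnSn _) i).
rewrite /num_plus /num_minus !num_pairs_mate // !lift0 /= !card_prefixS.
move: (mate_lt_number (e := c) (i := i)) (mate_lt_number (e := d) (i := i)).
case: (mate c i < i)%N => [/(_ isT) nc|_]; case: (mate d i < i)%N => [/(_ isT) nd|_];
  case: (c i) => [[]|?] //; case: (d i) => [[]|?] //=; rewrite /plus /minus /=;
  rewrite -?[inl _ == inl _]/(_ == _ :> bool) /=; lia.
Qed.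

(** The difference of the straddling counts with second index [t] and [t.+1] isolates the position
    [t]. *)
Lemma separation_mate_lt (i t : idx) : (i.+1 < t)%N ->
  (mate c t != t) && (mate c t < i.+1)%N = (mate d t != t) && (mate d t < i.+1)%N.
Proof.
move=> it; have ht := ltn_ord t.
have := straddling_eq (i := lift ord0 i) (j := widen_ord (leqnSn _) t).
have := straddling_eq (i := lift ord0 i) (j := lift ord0 t).
rewrite !num_straddling_mate // !lift0 /= !card_suffixS => /(_ (ltnW it)) -> /(_ it).
by move/addIn; do 2 case: (_ && _).
Qed.

Lemma separation_closing (t : idx) : (mate c t < t)%N -> mate c t = mate d t.
Proof.
move=> ct; have [_ _] := separation_type t; rewrite ct => /esym dt.
have [ctt dtt] : mate c t != t /\ mate d t != t by rewrite -!val_eqE !ltn_eqF.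
(* If the mates differ, the smaller one is at most [t - 2], so the strict bound of
   [separation_mate_lt] holds there and tells the clans apart. *)
apply/val_inj; case: (ltngtP (mate c t) (mate d t)) => // h.
  have := separation_mate_lt (leq_ltn_trans h dt); rewrite ctt dtt ltnSn /=.
  by rewrite ltnS leqNgt h.
have := separation_mate_lt (leq_ltn_trans h ct); rewrite ctt dtt ltnSn /=.
by rewrite ltnS leqNgt h.
Qed.

Lemma separation_mate : mate c = mate d.
Proof.
apply/funext => i; have [ip im ilt] := separation_type i.
case: (ltngtP (mate c i) i) => h; first exact: separation_closing.
  have := @separation_closing (mate c i); rewrite (mateK cc) => /(_ h) e.
  by rewrite [in RHS]e (mateK dc).
have : is_number (c i) = is_number (d i) by rewrite !is_number_sign ip im.
move/val_inj: h => h; have /negPf -> : ~~ is_number (c i) by rewrite -mate_fix // h.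
by move/esym/negbT => di; rewrite h mate_sign.
Qed.

Lemma clan_separation : clan_eq c d.
Proof.
split=> [i|i|i j]; try by have [] := separation_type i.
by rewrite !matchedE // separation_mate.
Qed.

End Separation.

Lemma DIII_paired n (c : clan_string n) : DIII_clan c -> paired predT (mate c)
  (is_plus c).
Proof. by case=> cc cs cd _; apply: clan_paired. Qed.

Lemma DIII_is_clan n (c : clan_string n) : DIII_clan c -> is_clan c.
Proof. by case. Qed.

(** * Orbits *)

Section Assembly.
Variables (C : numClosedFieldType) (n : nat).
Notation idx := 'I_(n + n).
Notation J := (antidiag_mx C (n + n)).
Notation K := (polar_mx C n).
Implicit Types (c d : clan_string n) (g l : 'M[C]_(n + n)).

Lemma clan_eq_repr_mx c d : is_clan c -> is_clan d -> clan_eq c d ->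
  repr_mx C c = repr_mx C d.
Proof.
move=> cc dc cd; have [p m e] := cd.
have md : mate c = mate d.
  by apply/funext => i; rewrite /mate (eq_pick (e i)).
have sd i : signature c i = signature d i.
  by rewrite !signatureE // md /is_plus p.
have dp : default_perm c = default_perm d.
  by apply/permP => i; rewrite !permE /default_fun sd.
by apply/matrixP => k i; rewrite !repr_mx_entry // /mate_coef /self_coef md dp.
Qed.

Lemma repr_flagE c : repr_flag C c = flag_of_mx (repr_mx C c).
Proof.
apply/ffunP => k; rewrite !ffunE; congr (<<_>>%VS); apply: eq_map => i.
by apply/matrixP => a b; rewrite !mxE ord1.
Qed.

Lemma SO_repr_mx c : DIII_clan c -> SO_group (repr_mx C c).
Proof.
move=> cD; have [cc _ _ par] := cD; have P := DIII_paired cD.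
split; last exact: repr_mx_antidiag.
by rewrite det_repr_mx // -signr_odd (negPf par).
Qed.

Lemma polar_block : K = block_mx 1%:M 0 0 (- 1%:M).
Proof.
apply/matrixP => i j; rewrite !mxE; case: splitP => a ia; rewrite !mxE;
  case: splitP => b jb; rewrite !mxE -!val_eqE /= ia jb.
- by [].
- by rewrite ltn_eqF // ltn_addr.
- by rewrite gtn_eqF ?mulr0n // ltn_addr.
by rewrite eqn_add2l mulNrn.
Qed.

Lemma antidiag_block : J = block_mx 0 (antidiag_mx C n) (antidiag_mx C n) 0.
Proof.
apply/matrixP => i j; rewrite !mxE; case: splitP => a ia; rewrite !mxE;
  case: splitP => b jb; rewrite !mxE -!val_eqE /= ia jb;
  do ?[case: eqP => ?] => //=; have := ltn_ord a; have := ltn_ord b; lia.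
Qed.

Lemma levi_polar l : levi l -> K *m l = l *m K.
Proof.
case=> A _ ->; rewrite polar_block !mulmx_block.
by rewrite !(mulmx0, mul0mx, addr0, add0r, mul1mx, mulmx1, mulNmx, mulmxN).
Qed.

(** Commuting with [K] kills the off-diagonal blocks; preserving [J] then determines the lower block
    from the upper one. *)
Lemma polar_levi l : l^T *m J *m l = J -> K *m l = l *m K -> levi l.
Proof.
rewrite -[l]submxK; move: (ulsubmx l) (ursubmx l) (dlsubmx l) (drsubmx l) => A B B' D.
move=> lJ; rewrite polar_block !mulmx_block.
rewrite !(mulmx0, mul0mx, addr0, add0r, mul1mx, mulmx1, mulNmx, mulmxN).
have N0 (X : 'M[C]_n) : X = - X -> X = 0.
  move=> e; apply/matrixP => i j; have := congr1 (fun X : 'M_n => X i j) e.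
  by rewrite /= [RHS]mxE => /self_opp_eq0 ->; rewrite mxE.
case/eq_block_mx => _ /N0 B0 /esym/N0 B'0 _; move: lJ; rewrite B0 B'0 antidiag_block.
rewrite tr_block_mx !trmx0 !mulmx_block !(mulmx0, mul0mx, addr0, add0r).
case/eq_block_mx => _ e _ _.
have eA : A^T *m (antidiag_mx C n *m D *m antidiag_mx C n) = 1%:M.
  by rewrite !mulmxA e antidiag_sqr.
have Au : A^T \in unitmx by have [] := mulmx1_unit eA.
exists A; first by rewrite -unitmx_tr.
rewrite trmx_inv -[X in block_mx _ _ _ X](_ : antidiag_mx C n *m (antidiag_mx C n *m D
  *m antidiag_mx C n) *m antidiag_mx C n = D).
  congr (block_mx _ _ _ (_ *m _ *m _)).
  by rewrite -[LHS](mulKmx Au) eA mulmx1.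
by rewrite !mulmxA antidiag_sqr mul1mx -mulmxA antidiag_sqr mulmx1.
Qed.

Lemma SO_mul (g h : 'M[C]_(n + n)) : SO_group g -> SO_group h -> SO_group (g *m h).
Proof.
move=> [dg fg] [dh fh]; split; first by rewrite det_mulmx dg dh mulr1.
by rewrite trmx_mul -!mulmxA (mulmxA J) (mulmxA g^T) (mulmxA g^T) fg mulmxA.
Qed.

Lemma polar_orbit c g : DIII_clan c -> SO_group g ->
  (forall k i, (K *m g) k i = tsign C (mate c) (is_plus c) i * g k (mate c i)) ->
  orbit_of_clan C c (flag_of_mx g).
Proof.
move=> cD Gg Kg; have P := DIII_paired cD; have cc := DIII_is_clan cD.
have gu := SO_unit Gg; split; first by exists g.
- by move=> k; apply: dim_flag_E.
- by move=> k; apply: dim_flag_Et.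
- by move=> i j; apply: dim_flag_pr.
Qed.

Lemma levi_orbit c l : DIII_clan c -> levi l ->
  orbit_of_clan C c (flag_of_mx (l *m repr_mx C c)).
Proof.
move=> cD Ll; have P := DIII_paired cD; have cc := DIII_is_clan cD.
apply: polar_orbit => //; first by apply: SO_mul; [exact: levi_SO | exact: SO_repr_mx].
move=> k i; rewrite mulmxA levi_polar // -mulmxA mxE.
under eq_bigr do rewrite polar_repr_mx // mulrCA.
by rewrite -mulr_sumr mxE.
Qed.

Lemma classification g : SO_group g -> exists c, DIII_clan c /\
  exists2 l, levi l & flag_of_mx g = flag_of_mx (l *m repr_mx C c).
Proof.
move=> Gg; have gu := SO_unit Gg; have [dg fg] := Gg.
have [T gT] : exists T, g *m T = K *m g.
  by exists (invmx g *m K *m g); rewrite !mulmxA mulmxV // mul1mx.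
have TT : T *m T = 1%:M.
  apply: (can_inj (mulKmx gu)); rewrite mulmx1 mulmxA gT -mulmxA gT mulmxA.
  by rewrite polar_sqr mul1mx.
have TJ : T^T *m J = - (J *m T).
  have e1 : J *m T = g^T *m J *m K *m g by rewrite -[in LHS]fg -(mulmxA _ g) gT !mulmxA.
  rewrite e1 -[in LHS]fg !mulmxA -trmx_mul gT trmx_mul.
  by rewrite -(mulmxA g^T K^T) polar_antidiag mulmxN mulNmx !mulmxA.
have [m [d [x [P bx _ _]]]] := normal_form TT TJ.
pose b := \matrix_(k, i) x i k 0.
have colb i : col i b = x i by apply/matrixP => k j; rewrite !mxE ord1.
have bJ : b^T *m J *m b = J.
  apply/matrixP => i j; have [_ _ /(_ j isT) e] := bx i isT.
  rewrite [RHS]mxE -e dotE mxE; apply: eq_bigr => k _.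
  by rewrite mul_antidiagE !mxE.
have Tb k i : (T *m b) k i = tsign C m d i * b k (m i).
  have [_ e _] := bx i isT; have := congr1 (fun y : 'cV_(n + n) => y k 0) e.
  by rewrite /= -!colb colE mulmxA -colE !mxE.
have trb : is_trig_mx b^T.
  by apply/is_trig_mxP => i j ij; rewrite !mxE; have [[xi _] _ _] := bx i isT;
    apply: xi.
(* The diagonal entries at [i] and [rev_ord i] have product [dot (x i) (x (rev_ord i))], which is
   1. *)
have db : \det b = 1.
  rewrite -det_tr det_trig // (bigID (fun i : idx => (i < n)%N)) /=.
  rewrite [X in _ * X](reindex_inj rev_ord_inj) /=.
  under [X in _ * X]eq_bigl do rewrite rev_half negbK.
  rewrite -big_split /= big1 // => i _; rewrite !mxE.
  have [[xi _] _ /(_ (rev_ord i) isT)] := bx i isT.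
  by have [[xr _] _ _] := bx (rev_ord i) isT; rewrite (dot_lead xi xr) eqxx.
have Bb : borel b by [].
pose c := clan_of m d.
have cc : is_clan c := clan_of_clan P.
have mc : mate c = m := mate_clan_of P.
have Pc : paired predT (mate c) (is_plus c).
  by apply: clan_paired => //; [exact: clan_of_sym | exact: clan_of_rev].
have tc i : tsign C (mate c) (is_plus c) i = tsign C m d i.
  by rewrite /tsign mc; case: eqP => // mi; rewrite /c clan_of_plus.
have [h hE] : exists h, h = g *m b by exists (g *m b).
have Gh : SO_group h by rewrite hE; apply: SO_mul => //; case: Bb.
have RJ := repr_mx_antidiag C cc Pc.
set r := repr_mx C c in RJ *.
have ru : r \in unitmx.
  have : J *m (r^T *m J *m r) = 1%:M by rewrite RJ antidiag_sqr.
  by rewrite !mulmxA => /mulmx1_unit[].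
have [l lr] : exists l, l *m r = h by exists (h *m invmx r); rewrite mulmxKV.
(* [l] preserves [J] because [h] and [r] do. It commutes with [K] because [K] acts on the columns of
   [h] and of [r] through the same signed involution. *)
have Ll : levi l.
  have [_ fh] := Gh; apply: polar_levi.
    have : r^T *m (l^T *m J *m l) *m r = r^T *m J *m r.
      by rewrite RJ -[RHS]fh -[h in RHS]lr trmx_mul !mulmxA.
    move/(congr1 (fun X => X *m invmx r)); rewrite !mulmxK //.
    by move/(congr1 (mulmx (invmx r^T))); rewrite !mulKmx ?unitmx_tr.
  suff : K *m l *m r = l *m K *m r by move/(congr1 (fun X => X *m invmx r));
    rewrite !mulmxK.
  rewrite -mulmxA lr hE mulmxA -gT -!mulmxA.
  have E1 : T *m b = b *m mirror m (tsign C m d) (fun=> 0).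
    by apply/matrixP => k i; rewrite Tb mul_mirror mulr0 addr0 mulrC.
  have E2 : K *m r = r *m mirror m (tsign C m d) (fun=> 0).
    by apply/matrixP => k i; rewrite polar_repr_mx // tc mc mul_mirror mulr0 addr0
      mulrC.
  by rewrite E1 E2 mulmxA (mulmxA l) lr hE.
have cD : DIII_clan c.
  split=> //; [exact: clan_of_sym | exact: clan_of_rev|].
  (* The parity condition is obtained only now, from the determinants of [h] and [l]. *)
  have : \det r = 1.
    by have := Gh.1; rewrite -lr det_mulmx (levi_SO Ll).1 mul1r.
  rewrite det_repr_mx // -signr_odd; case: (odd _) => //= /esym/self_opp_eq0/eqP.
  by rewrite oner_eq0.
exists c; split=> //; exists l => //; rewrite lr.
by apply/flag_of_mx_eqP => //; exists b.
Qed.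

Lemma orbit_separation c d V : DIII_clan c -> DIII_clan d ->
  orbit_of_clan C c V -> orbit_of_clan C d V -> clan_eq c d.
Proof.
move=> cD dD [_ c1 c2 c3] [_ d1 d2 d3].
apply: clan_separation; [exact: DIII_is_clan|exact: DIII_is_clan| | |].
- by move=> k; rewrite -c1 d1.
- by move=> k; rewrite -c2 d2.
by move=> i j ij; apply/eqP; rewrite -(eqn_add2l j) -c3 // d3.
Qed.

Lemma repr_orbit c : DIII_clan c -> orbit_of_clan C c (repr_flag C c).
Proof.
move=> cD; rewrite repr_flagE -[repr_mx C c]mul1mx; apply: levi_orbit => //.
exists 1%:M; first exact: unitmx1.
by rewrite invmx1 trmx1 mulmx1 antidiag_sqr -scalar_mx_block.
Qed.

(** By [classification] a flag satisfying the dimension conditions of [c] lies in the orbit of the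
    representative of some clan, and the dimensions force that clan to equal [c]. *)
Lemma orbit_of_clanE c : DIII_clan c -> orbit_of_clan C c = L_orbit (repr_flag C c).
Proof.
move=> cD; apply/seteqP; split=> V.
  move=> cV; have [[g Gg gV] _ _ _] := cV; move: cV; rewrite -gV.
  have [d [dD [l Ll ->]]] := classification Gg.
  move=> cV; have cd := orbit_separation cD dD cV (levi_orbit dD Ll).
  rewrite -(clan_eq_repr_mx (DIII_is_clan cD) (DIII_is_clan dD) cd).
  by exists l => //; rewrite repr_flagE act_flag_of_mx.
by case=> l Ll <-; rewrite repr_flagE act_flag_of_mx; apply: levi_orbit.
Qed.

Lemma LgBmodBE g : SO_group g -> LgBmodB g = L_orbit (flag_of_mx g).
Proof.
move=> Gg; apply/seteqP; split=> V.
  case=> _ [l Ll [b Bb <-]] <-; exists l => //; rewrite act_flag_of_mx.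
  have Gl := SO_mul (levi_SO Ll) Gg.
  by apply/flag_of_mx_eqP => //; [apply: SO_mul => //; case: Bb | exists b].
case=> l Ll <-; rewrite act_flag_of_mx; exists (l *m g) => //.
exists l => //; exists 1%:M; last by rewrite mulmx1.
split; first by split; [rewrite det1 | rewrite trmx1 mul1mx mulmx1].
by rewrite trmx1 scalar_mx_is_trig.
Qed.

Lemma levi_mul l1 l2 : levi l1 -> levi l2 -> levi (l1 *m l2).
Proof.
move=> L1 L2; have [_ f] := SO_mul (levi_SO L1) (levi_SO L2).
by apply: polar_levi => //; rewrite mulmxA levi_polar // -!mulmxA levi_polar.
Qed.

Lemma levi_inv l : levi l -> levi (invmx l).
Proof.
move=> Ll; have [_ f] := levi_SO Ll; have lu := SO_unit (levi_SO Ll).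
apply: polar_levi.
  rewrite -[in LHS]f !mulmxA -trmx_mul mulmxV // trmx1 mul1mx -mulmxA mulmxV //.
  by rewrite mulmx1.
by apply: (can_inj (mulKmx lu)); rewrite mulKVmx // mulmxA -levi_polar // mulmxK.
Qed.

Lemma L_orbit_act l g : levi l -> L_orbit (flag_of_mx (l *m g)) = L_orbit (flag_of_mx
  g).
Proof.
move=> Ll; have lu := SO_unit (levi_SO Ll); apply/seteqP; split=> V [h Lh <-].
  exists (h *m l); first exact: levi_mul.
  by rewrite !act_flag_of_mx mulmxA.
exists (h *m invmx l); first by apply: levi_mul => //; exact: levi_inv.
by rewrite !act_flag_of_mx mulmxA mulmxKV.
Qed.

Lemma L_orbits_clan O : @L_orbits C n O ->
  exists2 c, DIII_clan c & O = orbit_of_clan C c.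
Proof.
case=> V [g Gg <-] <-; have [c [cD [l Ll e]]] := classification Gg.
by exists c => //; rewrite orbit_of_clanE // repr_flagE e L_orbit_act.
Qed.

End Assembly.

Theorem theorem3p4 (R : realType) (n : nat) (hn : (1 <= n)%N) :
  (forall c : clan_string n, DIII_clan c ->
    [/\ L_orbits (orbit_of_clan R[i] c),
        orbit_of_clan R[i] c (repr_flag R[i] c),
        repr_flag R[i] c = flag_of_mx (repr_mx R[i] c),
        SO_group (repr_mx R[i] c) &
        orbit_of_clan R[i] c = LgBmodB (repr_mx R[i] c)]) /\
  (forall O : set (flag R[i] n), L_orbits O ->
    [/\ exists! V : flag R[i] n,
          O V /\ [set repr_flag R[i] c | c in @DIII_clan n] V,
        exists! g : 'M[R[i]]_(n + n),
          O (flag_of_mx g) /\ [set repr_mx R[i] c | c in @DIII_clan n] g &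
        forall c d : clan_string n, DIII_clan c -> DIII_clan d ->
          O (repr_flag R[i] c) -> O (repr_flag R[i] d) -> clan_eq c d]).
Proof.
split=> [c cD|O /L_orbits_clan[c cD ->]].
  have Gr := SO_repr_mx R[i] cD; have rE := repr_flagE R[i] c.
  split=> //; [|exact: repr_orbit|]; rewrite orbit_of_clanE // rE.
    by exists (flag_of_mx (repr_mx R[i] c)) => //; exists (repr_mx R[i] c).
  by rewrite LgBmodBE.
have sep d : DIII_clan d -> orbit_of_clan R[i] c (repr_flag R[i] d) -> clan_eq c d.
  by move=> dD cd; apply: orbit_separation cD dD cd (repr_orbit _ dD).
have req d : DIII_clan d -> orbit_of_clan R[i] c (repr_flag R[i] d) ->
    repr_mx R[i] c = repr_mx R[i] d.
  move=> dD cd; apply: clan_eq_repr_mx (sep _ dD cd); exact: DIII_is_clan.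
split.
- exists (repr_flag R[i] c); split; first by split; [exact: repr_orbit | exists c].
  by move=> V [+ [d dD dV]]; rewrite -dV => cV; rewrite !repr_flagE (req _ dD).
- exists (repr_mx R[i] c); split.
    by split; [rewrite -repr_flagE; exact: repr_orbit | exists c].
  by move=> g [+ [d dD dg]]; rewrite -dg => cg; apply: req => //; rewrite repr_flagE.
move=> c1 c2 D1 D2 O1 O2.
(* Both representatives coincide with that of [c], so the representative flag of [c1] also satisfies
   the conditions of [c2]. *)
apply: (orbit_separation D1 D2 (repr_orbit R[i] D1)).
by rewrite repr_flagE -(req _ D1 O1) (req _ D2 O2) -repr_flagE; exact: repr_orbit.
Qed.
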